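(* Let $\{(G_n,\mathcal M(G_n))\}_{n\ge1}$ be finite (random) marked networks, $G_n$ having vertex set $[n]$, with empirical rooted laws $\mathcal P_n$. Assume: (A1) for a common $L\in[0,1)$, every finite-network response $f_i$ is continuous and nondecreasing, satisfies $f_i(0)=0$ and has Lipschitz constant at most $L$; and the same conditions hold $\mathcal P$-almost surely at every vertex of the limiting forward component, where $\mathcal P$ is as in (A3); (A2) $M_\epsilon:=\sup_{n\ge1}\mathbb E[\|\epsilon(n)\|_\infty]<\infty$, where $\epsilon(n)=(\epsilon_i(n))_{i=1}^n$ is the vector of shocks; (A3) $\mathcal P_n\overset{\mathbb P}{\Rightarrow}\mathcal P$ for a deterministic rooted law $\mathcal P$. Then every finite system has a unique equilibrium $x^\star(n)=(x_i^\star(n))_{i=1}^n$, and, almost surely, the limiting forward component has a unique bounded equilibrium $x^\star$. For every bounded Lipschitz $\varphi:\mathbb R\to\mathbb R$, $$\frac1n\sum_{i=1}^n\varphi\bigl(x_i^\star(n)\bigr)\xrightarrow{\mathbb P}\mathbb E[\varphi(x_o^\star)].$$ Consequently, $x_{o_n}^\star(n)\Rightarrow x_o^\star$ (convergence in distribution).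
   Context: **Marks.** $\mathcal T$ is a Polish space (of types) with a complete compatible metric. For the fixed $L\in[0,1)$, $\mathsf F_{\mathrm c}$ is the set of continuous nondecreasing $f:\mathbb R\to\mathbb R$ with $f(0)=0$ and Lipschitz constant at most $L$, with metric $d_{\mathrm c}(f,g)=\sum_{q\ge1}2^{-q}\bigl(1\wedge\sup_{|z|\le q}|f(z)-g(z)|\bigr)$. The vertex-mark space is $\mathsf M^V=\mathcal T\times\mathbb R\times\mathsf F_{\mathrm c}$ with a complete product metric $d_{\mathsf M^V}$; a vertex $v$ has mark $m_v=(\tau_v,\epsilon_v,f_v)$ (type, shock, response). The edge-mark space is $\mathsf M^E=(0,\infty)$ with $d_{\mathsf M^E}(c,c')=|\log c-\log c'|$; an edge $(v,u)$ has mark $C_{vu}>0$ (exposure). **Rooted marked graphs and local topology.** A directed graph $G=(V,E)$ is forward locally finite if every vertex has finite out-degree (in-degrees are unrestricted). A rooted marked directed graph $(G,o,\mathcal M(G))$ is such a graph with a root $o\in V$ and marks $m_v\in\mathsf M^V$, $m_e\in\mathsf M^E$. An isomorphism is a vertex bijection preserving edges in both directions, the root, and all marks; $\mathcal G_*$ is the set of isomorphism classes. Let $d_G^+(o,v)$ be the length of a shortest directed path from $o$ to $v$ ($\infty$ if none), $V_k^+(o)=\{v:d_G^+(o,v)\le k\}$ and $E_k^+(o)=\{(v,u)\in E:d_G^+(o,v)<k\}$. For $\xi=[G,o,\mathcal M(G)]$, $[\xi]_k$ is the isomorphism class of the rooted marked graph with vertex set $V_k^+(o)$, edge set $E_k^+(o)$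 and the original marks; $\mathfrak X_k$ is the set of such classes. Put $d_V=1\wedge d_{\mathsf M^V}$, $d_E=1\wedge d_{\mathsf M^E}$. For $a,b\in\mathfrak X_r$ let $d_r(a,b)=1$ if there is no root-preserving isomorphism of the underlying directed graphs (ignoring marks), and otherwise $d_r(a,b)=\min_\phi\max\{\max_v d_V(m_v,m'_{\phi(v)}),\max_{(v,u)}d_E(m_{(v,u)},m'_{(\phi(v),\phi(u))})\}$ over such isomorphisms $\phi$ (an empty maximum is $0$). Set $d_{\mathrm{loc}}(\xi,\xi')=\sum_{r\ge0}2^{-r-1}d_r([\xi]_r,[\xi']_r)$, and let $\widetilde{\mathcal G}_*$ be the quotient of $\mathcal G_*$ by $\{d_{\mathrm{loc}}=0\}$, a Polish space with metric $d_{\mathrm{loc}}$. **Empirical rooted laws.** $\mathcal P_n=\frac1n\sum_{i=1}^n\delta_{[G_n,i,\mathcal M(G_n)]}$, a random probability measure on $\widetilde{\mathcal G}_*$. For a deterministic law $\mathcal P$, $\mathcal P_n\overset{\mathbb P}{\Rightarrow}\mathcal P$ means $\int h\,d\mathcal P_n\to\int h\,d\mathcal P$ in probability for every bounded continuous $h:\widetilde{\mathcal G}_*\to\mathbb R$. **Weights and equilibria.** For an edge, $W_{vu}=C_{vu}/\sum_{w:(v,w)\in E}C_{vw}$; absent edges have weight $0$, so vertices without outgoing edges have zero network input. On $G_n$ write $W_{ij}(n),\tau_i(n),\epsilon_i(n),f_i$. An equilibrium of the finite network is a vector with $x_i=f_i\bigl(\sum_jW_{ij}(n)x_j+\epsilon_i(n)\bigr)$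 for all $i\in[n]$. **Limit.** $(G,o,\mathcal M(G))$ denotes a random rooted network with law $\mathcal P$, where $G$ is taken to be the root's forward component, $V(G)=\bigcup_{r\ge0}V_r^+(o)$. A bounded equilibrium on it is $x\in\ell^\infty(V(G))$ with $x_v=f_v\bigl(\sum_{u:(v,u)\in E(G)}W_{vu}x_u+\epsilon_v\bigr)$ for all $v$; $x_o^\star$ is the root coordinate of $x^\star$. **Sampling.** $o_n$ is uniform on $[n]$ conditionally on the marked network. *)

(* Defs.v *)
From HB Require Import structures.
From mathcomp Require Import all_boot all_order all_algebra lra generic_quotient.
From mathcomp Require Import all_classical all_reals all_analysis.

Set Implicit Arguments.
Unset Strict Implicit.
Unset Printing Implicit Defensive.

Import Order.TTheory GRing.Theory Num.Theory.
Import numFieldTopology.Exports numFieldNormedType.Exports.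

Local Open Scope classical_set_scope.
Local Open Scope ring_scope.
Local Open Scope quotient_scope.

HB.mixin Record isSeparable T & Topological T := {
  separable_subproof : exists2 S : set T, countable S & dense S
}.

(* The complete compatible metric is part of the structure. Through Complete,
   the space is pointed, which only excludes the empty space. *)
#[short(type="polishType")]
HB.structure Definition Polish (R : numDomainType) :=
  {T of Metric R T & Complete T & isSeparable T}.

Definition borel (X : ptopologicalType) :=
  g_sigma_algebraType (@open X).

(* sum_(r >= 0) 2^(-r-1) u_r *)
Section weighted_sum.
Variable R : realType.
Implicit Types u v w : nat -> R.

Definition wsum u : R := limn (series (fun r => 2^-1 ^+ r.+1 * u r)).

Let wseries u := series (fun r => 2^-1 ^+ r.+1 * u r).

Let bound01 u := forall r, 0 <= u r <= 1.

Lemma wsum_cvg u : bound01 u -> cvgn (wseries u).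
Proof.
move=> u01; apply: (@series_le_cvg _ _ (geometric 2^-1 2^-1)).
- by move=> r; apply: mulr_ge0; [exact: exprn_ge0|by case/andP: (u01 r)].
- by move=> r; rewrite /geometric /= mulr_ge0// exprn_ge0.
- move=> r; rewrite /geometric /= -exprS -[leRHS]mulr1 ler_wpM2l//.
  by case/andP: (u01 r).
- apply: is_cvg_geometric_series.
  by rewrite ger0_norm// invf_lt1// ltr1n.
Qed.

Lemma wsum_eq0 u : (forall r, u r = 0) -> wsum u = 0.
Proof.
move=> u0; rewrite /wsum (_ : series _ = cst 0) ?lim_cst//.
by apply/funext => n; rewrite /series/= big1// => r _; rewrite u0 mulr0.
Qed.

Lemma wsum_triangle u v w : bound01 u -> bound01 v -> bound01 w ->
  (forall r, u r <= v r + w r) -> wsum u <= wsum v + wsum w.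
Proof.
move=> u01 v01 w01 uvw.
have cu := wsum_cvg u01; have cv := wsum_cvg v01; have cw := wsum_cvg w01.
rewrite /wsum -lim_seriesD//; apply: lim_series_le => //.
  exact: is_cvg_seriesD.
by move=> r; rewrite /= -mulrDr ler_wpM2l.
Qed.

Lemma wsum_inj0 u : bound01 u -> wsum u = 0 -> forall r, u r = 0.
Proof.
move=> u01 s0 r; have cu := wsum_cvg u01.
have tge0 k : 0 <= 2^-1 ^+ k.+1 * u k.
  by apply: mulr_ge0; [exact: exprn_ge0|by case/andP: (u01 k)].
have nd : nondecreasing_seq (wseries u).
  by apply/nondecreasing_seqP => n; rewrite /wseries seriesSr lerDl.
have := nondecreasing_cvgn_le nd cu r.+1.
rewrite -[limn _]/(wsum u) s0 /wseries seriesSr => le0.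
have s_ge0 : 0 <= series (fun r => 2^-1 ^+ r.+1 * u r) r.
  by rewrite /series/= sumr_ge0.
have t0 : 2^-1 ^+ r.+1 * u r = 0.
  apply/eqP; rewrite eq_le tge0 andbT.
  by apply: le_trans le0; rewrite lerDr.
by move/eqP: t0; rewrite mulf_eq0 expf_eq0/= invr_eq0 (eqr_nat R 2 0)/= => /eqP.
Qed.

End weighted_sum.

Section truncated_distance.
Variable R : realType.
Implicit Types a b c : R.

Lemma min1_01 a : 0 <= a -> 0 <= Num.min 1 a <= 1.
Proof. by move=> a0; rewrite le_min ler01 a0 ge_min lexx. Qed.

Lemma min1_triangle a b c : 0 <= b -> 0 <= c -> a <= b + c ->
  Num.min 1 a <= Num.min 1 b + Num.min 1 c.
Proof.
move=> b0 c0 abc; rewrite /Num.min.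
by case: (ltP 1 a); case: (ltP 1 b); case: (ltP 1 c) => *; lra.
Qed.

Lemma min1_eq0 a : Num.min 1 a = 0 -> a = 0.
Proof.
rewrite minEle; case: ifP => // _ /eqP; by rewrite oner_eq0.
Qed.

End truncated_distance.

Section response.
Variables (R : realType) (L : {nonneg R}).

(* The space F_c. The standing assumptions on the response functions of finite
   and limiting networks are carried by this type, since vertex marks take
   their response here. *)
Record response := Response {
  response_fun :> R -> R ;
  response_continuous : continuous response_fun ;
  response_homo : {homo response_fun : x y / x <= y} ;
  response0 : response_fun 0 = 0 ;
  response_lipschitz : forall x y : R,
    `|response_fun x - response_fun y| <= L%:num * `|x - y|
}.

HB.instance Definition _ := gen_eqMixin response.
HB.instance Definition _ := gen_choiceMixin response.

Let zero_response : response.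
Proof.
apply: (@Response (cst 0)) => //.
- by move=> x; exact: cvg_cst.
- by move=> x y; rewrite /cst subrr normr0 mulr_ge0.
Defined.

HB.instance Definition _ := isPointed.Build response zero_response.

Definition sup_dist_on (q : nat) (f g : R -> R) : R :=
  sup [set `|f z - g z| | z in [set z | `|z| <= q%:R]].

(* q >= 1 is encoded as r.+1 *)
Definition response_dist (f g : response) : R :=
  wsum (fun r => Num.min 1 (sup_dist_on r.+1 f g)).

Lemma sup_dist_on_ubound q (f g : response) z : `|z| <= q%:R ->
  `|f z - g z| <= sup_dist_on q f g.
Proof.
move=> zq; apply: ub_le_sup; last by exists z.
exists (L%:num * q%:R + L%:num * q%:R) => _ [y /= yq <-].
have h (k : response) : `|k y| <= L%:num * q%:R.
  rewrite -[k y]subr0 -(response0 k).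
  apply: le_trans (response_lipschitz k y 0) _.
  by rewrite subr0 ler_wpM2l.
by apply: le_trans (ler_normB _ _) _; rewrite lerD.
Qed.

Lemma sup_dist_on_le q (f g : response) a :
  (forall z, `|z| <= q%:R -> `|f z - g z| <= a) -> sup_dist_on q f g <= a.
Proof.
move=> h; apply: ge_sup; first by exists `|f 0 - g 0|; exists 0 => //=; rewrite normr0.
by move=> _ [z zq <-]; exact: h.
Qed.

Lemma sup_dist_on_ge0 q (f g : response) : 0 <= sup_dist_on q f g.
Proof.
apply: le_trans (sup_dist_on_ubound (z := 0) f g _) => //.
by rewrite normr0.
Qed.

Let term01 (f g : response) r : 0 <= Num.min 1 (sup_dist_on r.+1 f g) <= 1.
Proof. by rewrite min1_01// sup_dist_on_ge0. Qed.

Lemma response_dist_xx f : response_dist f f = 0.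
Proof.
apply: wsum_eq0 => r; rewrite (_ : sup_dist_on _ _ _ = 0).
  by rewrite minEle ler10.
apply/eqP; rewrite eq_le sup_dist_on_ge0 andbT.
by apply: sup_dist_on_le => z _; rewrite subrr normr0.
Qed.

Lemma response_dist_eq0 f g : response_dist f g = 0 -> f = g.
Proof.
move=> /(wsum_inj0 (term01 f g)) h.
have fg : response_fun f = response_fun g.
  apply/funext => z.
  pose q := Num.bound `|z|.
  have zq : `|z| <= q.+1%:R.
    by apply: le_trans (ltW (archi_boundP (normr_ge0 z))) _; rewrite ler_nat.
  have := sup_dist_on_ubound f g zq.
  by rewrite (min1_eq0 (h q)) normr_le0 subr_eq0 => /eqP.
case: f g {h} fg => f f1 f2 f3 f4 [g g1 g2 g3 g4] /= fg; subst g.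
by congr Response; exact: Prop_irrelevance.
Qed.

Lemma response_dist_sym f g : response_dist f g = response_dist g f.
Proof.
congr wsum; apply/funext => r; congr Num.min; congr sup.
by apply/seteqP; split=> _ [z zr <-]; exists z => //; rewrite distrC.
Qed.

Lemma response_dist_triangle g f h :
  response_dist f h <= response_dist f g + response_dist g h.
Proof.
apply: wsum_triangle => // r; apply: min1_triangle.
- exact: sup_dist_on_ge0.
- exact: sup_dist_on_ge0.
- apply: sup_dist_on_le => z zr.
  rewrite (le_trans (ler_distD (g z) _ _))// lerD//;
    exact: sup_dist_on_ubound.
Qed.

HB.instance Definition _ := isMetric.Build R response
  response_dist_xx response_dist_eq0 response_dist_sym response_dist_triangle.

End response.

Section vertex_mark.
Variables (R : realType) (L : {nonneg R}) (T : polishType R).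

Record vertex_mark := VertexMark {
  vtype : T ;
  vshock : R ;
  vresp : response L
}.

HB.instance Definition _ := gen_eqMixin vertex_mark.
HB.instance Definition _ := gen_choiceMixin vertex_mark.
HB.instance Definition _ :=
  isPointed.Build vertex_mark (VertexMark point 0 point).

(* The product metric is the maximum of the coordinate metrics. *)
Definition vertex_mark_dist (m m' : vertex_mark) : R :=
  Num.max (mdist (vtype m) (vtype m'))
    (Num.max `|vshock m - vshock m'| (mdist (vresp m) (vresp m'))).

Lemma vertex_mark_dist_xx m : vertex_mark_dist m m = 0.
Proof. by rewrite /vertex_mark_dist !mdistxx subrr normr0 !maxxx. Qed.

Lemma vertex_mark_dist_eq0 m m' : vertex_mark_dist m m' = 0 -> m = m'.
Proof.
move=> d0.
have : vertex_mark_dist m m' <= 0 by rewrite d0.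
rewrite /vertex_mark_dist !ge_max => /and3P[h1 h2 h3].
case: m m' h1 h2 h3 {d0} => [t e f] [t' e' f'] /= h1 h2 h3.
have := mdist_ge0 t t'; rewrite le0r ltNge h1 orbF => /eqP/mdist_positivity ->.
move: h2; rewrite normr_le0 subr_eq0 => /eqP ->.
by have := mdist_ge0 f f'; rewrite le0r ltNge h3 orbF => /eqP/mdist_positivity ->.
Qed.

Lemma vertex_mark_dist_sym m m' : vertex_mark_dist m m' = vertex_mark_dist m' m.
Proof.
by rewrite /vertex_mark_dist (metric_sym (vtype m)) distrC (metric_sym (vresp m)).
Qed.

Lemma vertex_mark_dist_triangle m' m m'' :
  vertex_mark_dist m m'' <= vertex_mark_dist m m' + vertex_mark_dist m' m''.
Proof.
rewrite /vertex_mark_dist !ge_max; apply/and3P; split.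
- apply: le_trans (metric_triangle _ (vtype m') _) _.
  by apply: lerD; rewrite le_max lexx.
- apply: le_trans (ler_distD (vshock m') _ _) _.
  by apply: lerD; rewrite !le_max lexx orbT.
- apply: le_trans (metric_triangle _ (vresp m') _) _.
  by apply: lerD; rewrite !le_max lexx !orbT.
Qed.

HB.instance Definition _ := isMetric.Build R vertex_mark
  vertex_mark_dist_xx vertex_mark_dist_eq0 vertex_mark_dist_sym
  vertex_mark_dist_triangle.

Definition vertex_dist1 (m m' : vertex_mark) : R := Num.min 1 (mdist m m').

Definition edge_dist1 (c c' : {posnum R}) : R :=
  Num.min 1 `|ln c%:num - ln c'%:num|.

End vertex_mark.

Section marked_graphs.
Variables (R : realType) (L : {nonneg R}) (T : polishType R).

(* [exposure v u] is the mark of the edge (v, u); it is meaningful only when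
   [edge v u] holds, and nothing below reads it otherwise. *)
Record mgraph (V : Type) := MGraph {
  edge : V -> V -> Prop ;
  out_finite : forall v, finite_set (edge v) ;
  mark : V -> vertex_mark L T ;
  exposure : V -> V -> {posnum R}
}.

HB.instance Definition _ V := gen_eqMixin (mgraph V).
HB.instance Definition _ V := gen_choiceMixin (mgraph V).

Let empty_mgraph V : mgraph V :=
  @MGraph V (fun _ _ => False) (fun _ => @finite_set0 V) (fun _ => point)
    (fun _ _ => 1%:pos).

HB.instance Definition _ V := isPointed.Build (mgraph V) (empty_mgraph V).

Definition weight (V : choiceType) (G : mgraph V) (v u : V) : R :=
  if `[< edge G v u >]
  then (exposure G v u)%:num / \sum_(w \in edge G v) (exposure G v w)%:num
  else 0.

Definition is_equilibrium (V : choiceType) (G : mgraph V) (x : V -> R) :=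
  forall v, x v = vresp (mark G v)
    (\sum_(u \in edge G v) weight G v u * x u + vshock (mark G v)).

Definition network n := mgraph 'I_n.

Definition is_network_equilibrium n (G : network n) (x : 'I_n -> R) :=
  forall i, x i = vresp (mark G i)
    (\sum_(j < n) weight G i j * x j + vshock (mark G i)).

Definition shock_norm n (G : network n) : R :=
  \big[Num.max/0]_(i < n) `|vshock (mark G i)|.

(* The smallest sigma-algebra making the edge indicators, the vertex marks and
   the edge marks (where they are defined) measurable. *)
Definition network_generators n : set (set (network n)) :=
  [set A | exists i j, A = [set G | edge G i j]]
  `|` [set A | exists i, exists2 B, open B & A = [set G | B (mark G i)]]
  `|` [set A | exists i j, exists2 B : set R, open B &
         A = [set G | edge G i j /\ B (exposure G i j)%:num]].

Definition measurable_network n := g_sigma_algebraType (@network_generators n).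
HB.instance Definition _ n := Measurable.on (measurable_network n).

(* The vertex type is a bare Type: a choiceType field would put [rooted_graph] in a
   universe too large for it to be a choiceType itself. *)
Record rooted_graph := RootedGraph {
  vertex : Type ;
  graph :> mgraph vertex ;
  groot : vertex
}.

HB.instance Definition _ := gen_eqMixin rooted_graph.
HB.instance Definition _ := gen_choiceMixin rooted_graph.
HB.instance Definition _ :=
  isPointed.Build rooted_graph (@RootedGraph unit point tt).

Fixpoint walk V (e : V -> V -> Prop) n (v u : V) : Prop :=
  if n is m.+1 then exists2 w, e v w & walk e m w u else v = u.

(* d^+(root, v) <= k *)
Definition dplus_le (g : rooted_graph) k (v : vertex g) :=
  exists2 n, (n <= k)%N & walk (edge g) n (groot g) v.
Arguments dplus_le : clear implicits.

(* d^+(root, v) < k *)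
Definition dplus_lt (g : rooted_graph) k (v : vertex g) :=
  exists2 n, (n < k)%N & walk (edge g) n (groot g) v.
Arguments dplus_lt : clear implicits.

Lemma root_dplus_le (g : rooted_graph) k : dplus_le g k (groot g).
Proof. by exists 0%N. Qed.

Lemma out_finite_inj (V W : Type) (G : mgraph V) (f : W -> V)
  (e : W -> W -> Prop) : injective f ->
  (forall v u, e v u -> edge G (f v) (f u)) -> forall v, finite_set (e v).
Proof.
move=> f_inj sub_e v; apply: (@sub_finite_set _ _ (f @^-1` edge G (f v))).
  by move=> u /= /sub_e.
by apply: finite_preimage (out_finite G _) => u u' _ _; exact: f_inj.
Qed.

Lemma sval_inj (V : Type) (P : V -> Prop) : injective (@sval V P).
Proof.
by move=> u u'; exact: eq_sig_hprop (fun _ _ _ => Prop_irrelevance _ _) _ _.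
Qed.

(* A representative of [xi]_r: vertices V_r^+, edges E_r^+, original marks. *)
Definition ball_graph r (g : rooted_graph) : rooted_graph :=
  @RootedGraph {v | dplus_le g r v}
    (@MGraph {v | dplus_le g r v}
      (fun v u => edge g (sval v) (sval u) /\ dplus_lt g r (sval v))
      (@out_finite_inj _ _ g _ _ (@sval_inj _ _) (fun _ _ => @proj1 _ _))
      (fun v => mark g (sval v))
      (fun v u => exposure g (sval v) (sval u)))
    (exist _ (groot g) (root_dplus_le g r)).

Definition reachable (g : rooted_graph) (v : vertex g) := exists r, dplus_le g r v.

Definition forward_component (g : rooted_graph) : rooted_graph :=
  @RootedGraph {v | reachable v}
    (@MGraph {v | reachable v}
      (fun v u => edge g (sval v) (sval u))
      (@out_finite_inj _ _ g _ _ (@sval_inj _ _) (fun _ _ => id))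
      (fun v => mark g (sval v))
      (fun v u => exposure g (sval v) (sval u)))
    (exist _ (groot g) (ex_intro _ 0%N (root_dplus_le g 0))).

Definition ordinal_of n (k : {k : nat | (k < n)%N}) : 'I_n :=
  Ordinal (svalP k).

Lemma ordinal_of_inj n : injective (@ordinal_of n).
Proof. by move=> k l /(congr1 val)/= /sval_inj. Qed.

(* The network G rooted at i. The vertex set [n] is encoded as
   {k : nat | k < n} because the universe of ordinal is too large for
   [vertex]. *)
Definition rooted_network n (G : network n) (i : 'I_n) : rooted_graph :=
  @RootedGraph {k : nat | (k < n)%N}
    (@MGraph {k : nat | (k < n)%N}
      (fun v u => edge G (ordinal_of v) (ordinal_of u))
      (@out_finite_inj _ _ G _ _ (@ordinal_of_inj n) (fun _ _ => id))
      (fun v => mark G (ordinal_of v))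
      (fun v u => exposure G (ordinal_of v) (ordinal_of u)))
    (exist _ (val i) (ltn_ord i)).

(* [{classic V}] only adds a choiceType structure to V. *)
Definition is_bounded_equilibrium (g : rooted_graph)
    (x : {classic vertex g} -> R) :=
  bounded_fun x /\ is_equilibrium (graph g : mgraph {classic vertex g}) x.

Definition root_iso (a b : rooted_graph) : set (vertex a -> vertex b) :=
  [set phi : vertex a -> vertex b | [/\ bijective phi, phi (groot a) = groot b &
    forall v u, edge a v u <-> edge b (phi v) (phi u)]].
Arguments root_iso : clear implicits.

(* [sup set0 = 0]. *)
Definition mark_discrepancy (a b : rooted_graph) (phi : vertex a -> vertex b) : R :=
  Num.max
    (sup [set vertex_dist1 (mark a v) (mark b (phi v)) | v in setT])
    (sup [set edge_dist1 (exposure a e.1 e.2) (exposure b (phi e.1) (phi e.2))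
         | e in [set e | edge a e.1 e.2]]).

(* Used on balls, which are finite, so that the suprema and the infimum are
   attained. *)
Definition rooted_dist (a b : rooted_graph) : R :=
  if `[< root_iso a b !=set0 >]
  then inf ((@mark_discrepancy a b) @` root_iso a b)
  else 1.

Definition dloc (g h : rooted_graph) : R :=
  wsum (fun r => rooted_dist (ball_graph r g) (ball_graph r h)).

End marked_graphs.

Arguments root_iso {R L T} a b _.
Arguments dplus_le {R L T} g k v.
Arguments dplus_lt {R L T} g k v.

Section local_metric.
Variables (R : realType) (L : {nonneg R}) (T : polishType R).
Implicit Types a b c g h : rooted_graph L T.

Let vertex_dist1_01 (m m' : vertex_mark L T) : 0 <= vertex_dist1 m m' <= 1.
Proof. by apply: min1_01; exact: mdist_ge0. Qed.

Let edge_dist1_01 (c c' : {posnum R}) : 0 <= edge_dist1 c c' <= 1.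
Proof. exact: min1_01. Qed.

Lemma vertex_dist1_le_discrepancy a b (phi : vertex a -> vertex b) v :
  vertex_dist1 (mark a v) (mark b (phi v)) <= mark_discrepancy phi.
Proof.
rewrite le_max; apply/orP; left; apply: ub_le_sup; last by exists v.
by exists 1 => _ [w _ <-]; case/andP: (vertex_dist1_01 (mark a w) (mark b (phi w))).
Qed.

Lemma edge_dist1_le_discrepancy a b (phi : vertex a -> vertex b) v u :
  edge a v u ->
  edge_dist1 (exposure a v u) (exposure b (phi v) (phi u)) <= mark_discrepancy phi.
Proof.
move=> vu; rewrite le_max; apply/orP; right; apply: ub_le_sup; last by exists (v, u).
exists 1 => _ [e _ <-].
by case/andP: (edge_dist1_01 (exposure a e.1 e.2) (exposure b (phi e.1) (phi e.2))).
Qed.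

Lemma discrepancy_le a b (phi : vertex a -> vertex b) x : 0 <= x ->
  (forall v, vertex_dist1 (mark a v) (mark b (phi v)) <= x) ->
  (forall v u, edge a v u ->
     edge_dist1 (exposure a v u) (exposure b (phi v) (phi u)) <= x) ->
  mark_discrepancy phi <= x.
Proof.
move=> x0 hv he; rewrite ge_max; apply/andP; split.
  apply: ge_sup; last by move=> _ [v _ <-].
  by exists (vertex_dist1 (mark a (groot a)) (mark b (phi (groot a)))), (groot a).
have [->|/set0P ne] := eqVneq [set e | edge a e.1 e.2] set0.
  by rewrite image_set0 sup0.
apply: ge_sup; last by move=> _ [[v u] /= vu <-]; exact: he.
by case: ne => e ve; eexists; exists e.
Qed.

Lemma discrepancy01 a b (phi : vertex a -> vertex b) :
  0 <= mark_discrepancy phi <= 1.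
Proof.
apply/andP; split.
  apply: le_trans (vertex_dist1_le_discrepancy phi (groot a)).
  by case/andP: (vertex_dist1_01 (mark a (groot a)) (mark b (phi (groot a)))).
apply: discrepancy_le => // [v|v u _].
  by case/andP: (vertex_dist1_01 (mark a v) (mark b (phi v))).
by case/andP: (edge_dist1_01 (exposure a v u) (exposure b (phi v) (phi u))).
Qed.

Lemma rooted_dist_le a b (phi : vertex a -> vertex b) :
  root_iso a b phi -> rooted_dist a b <= mark_discrepancy phi.
Proof.
move=> iphi; rewrite /rooted_dist asboolT; last by exists phi.
apply: ge_inf; last by exists phi.
by exists 0 => _ [psi _ <-]; case/andP: (discrepancy01 psi).
Qed.

Lemma le_rooted_dist a b x : root_iso a b !=set0 ->
  (forall phi, root_iso a b phi -> x <= mark_discrepancy phi) ->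
  x <= rooted_dist a b.
Proof.
move=> ne h; rewrite /rooted_dist asboolT//; apply: lb_le_inf.
  by case: ne => phi iphi; exists (mark_discrepancy phi), phi.
by move=> _ [phi iphi <-]; exact: h.
Qed.

Lemma rooted_dist_noniso a b : ~ (root_iso a b !=set0) -> rooted_dist a b = 1.
Proof. by move=> ni; rewrite /rooted_dist asboolF. Qed.

Lemma rooted_dist01 a b : 0 <= rooted_dist a b <= 1.
Proof.
have [ne|/rooted_dist_noniso ->] := pselect (root_iso a b !=set0); last first.
  by rewrite ler01 lexx.
apply/andP; split.
  by apply: le_rooted_dist => // phi _; case/andP: (discrepancy01 phi).
case: ne => phi /rooted_dist_le/le_trans; apply.
by case/andP: (discrepancy01 phi).
Qed.

Lemma rooted_dist_xx a : rooted_dist a a = 0.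
Proof.
apply/eqP; rewrite eq_le; case/andP: (rooted_dist01 a a) => -> _; rewrite andbT.
have iid : root_iso a a id by split => //; exists id.
apply: le_trans (rooted_dist_le iid) _; apply: discrepancy_le => // [v|v u _].
  by rewrite /vertex_dist1 mdistxx minEle ler10.
by rewrite /edge_dist1 subrr normr0 minEle ler10.
Qed.

Let root_iso_inv a b (phi : vertex a -> vertex b) : root_iso a b phi ->
  exists2 psi, root_iso b a psi & mark_discrepancy psi <= mark_discrepancy phi.
Proof.
move=> [[psi phiK psiK] phir phie]; exists psi.
  split; first by exists phi.
    by rewrite -phir phiK.
  by move=> v u; rewrite phie !psiK.
apply: discrepancy_le; first by case/andP: (discrepancy01 phi).
  move=> v; have := vertex_dist1_le_discrepancy phi (psi v).
  by rewrite psiK /vertex_dist1 metric_sym.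
move=> v u vu; have := @edge_dist1_le_discrepancy _ _ phi (psi v) (psi u).
by rewrite phie !psiK /edge_dist1 distrC; exact.
Qed.

Lemma rooted_dist_sym a b : rooted_dist a b = rooted_dist b a.
Proof.
suff le_ab a' b' : rooted_dist a' b' <= rooted_dist b' a'.
  by apply/eqP; rewrite eq_le !le_ab.
have [ne|/rooted_dist_noniso ->] := pselect (root_iso b' a' !=set0); last first.
  by case/andP: (rooted_dist01 a' b').
apply: le_rooted_dist => // phi /root_iso_inv[psi ipsi le_psi].
exact: le_trans (rooted_dist_le ipsi) le_psi.
Qed.

Lemma rooted_dist_triangle b a c :
  rooted_dist a c <= rooted_dist a b + rooted_dist b c.
Proof.
have /andP[_ ac1] := rooted_dist01 a c.
have /andP[ab0 _] := rooted_dist01 a b.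
have /andP[bc0 _] := rooted_dist01 b c.
have [nab|/rooted_dist_noniso ->] := pselect (root_iso a b !=set0); last first.
  by rewrite (le_trans ac1)// lerDl.
have [nbc|/rooted_dist_noniso ->] := pselect (root_iso b c !=set0); last first.
  by rewrite (le_trans ac1)// lerDr.
rewrite -lerBlDr; apply: le_rooted_dist => // phi iphi.
rewrite lerBlDr -lerBlDl; apply: le_rooted_dist => // psi ipsi.
rewrite lerBlDl.
have iso : root_iso a c (psi \o phi).
  case: iphi => phib phir phie; case: ipsi => psib psir psie; split.
  - exact: bij_comp.
  - by rewrite /= phir psir.
  - by move=> v u; rewrite phie psie.
apply: le_trans (rooted_dist_le iso) _; apply: discrepancy_le.
- by apply: addr_ge0; [case/andP: (discrepancy01 phi)|case/andP: (discrepancy01 psi)].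
- move=> v; apply: le_trans
    (lerD (vertex_dist1_le_discrepancy phi v) (vertex_dist1_le_discrepancy psi (phi v))).
  by apply: min1_triangle; rewrite ?mdist_ge0//; exact: metric_triangle.
- move=> v u vu; have vu' : edge b (phi v) (phi u).
    by case: iphi => _ _ <-.
  apply: le_trans (lerD (edge_dist1_le_discrepancy phi vu)
    (edge_dist1_le_discrepancy psi vu')).
  by apply: min1_triangle => //; exact: ler_distD.
Qed.

Lemma dloc_xx g : dloc g g = 0.
Proof. by apply: wsum_eq0 => r; exact: rooted_dist_xx. Qed.

Lemma dloc_sym g h : dloc g h = dloc h g.
Proof. by congr wsum; apply/funext => r; exact: rooted_dist_sym. Qed.

Lemma dloc_triangle h g g' : dloc g g' <= dloc g h + dloc h g'.
Proof.
by apply: wsum_triangle => r; [exact: rooted_dist01..|exact: rooted_dist_triangle].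
Qed.

Lemma dloc_ge0 g h : 0 <= dloc g h.
Proof.
rewrite -(@pmulrn_lge0 _ _ 2)// -(dloc_xx g).
by rewrite (le_trans (dloc_triangle h g g))// (dloc_sym h) mulr2n.
Qed.

Definition dloc_zero : rel (rooted_graph L T) := fun g h => dloc g h == 0.

Lemma dloc_zero_refl : reflexive dloc_zero.
Proof. by move=> g; rewrite /dloc_zero dloc_xx. Qed.

Lemma dloc_zero_sym : symmetric dloc_zero.
Proof. by move=> g h; rewrite /dloc_zero dloc_sym. Qed.

Lemma dloc_zero_trans : transitive dloc_zero.
Proof.
move=> h g g' /eqP gh /eqP hg'; rewrite /dloc_zero eq_le dloc_ge0 andbT.
by rewrite (le_trans (dloc_triangle h g g'))// gh hg' addr0.
Qed.

Canonical dloc_equiv : equiv_rel (rooted_graph L T) :=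
  EquivRel dloc_zero dloc_zero_refl dloc_zero_sym dloc_zero_trans.

(* Isomorphic rooted marked graphs are at distance 0, so this is also the
   quotient of the set of isomorphism classes by [dloc = 0]. *)
Definition local_space := {eq_quot dloc_zero}.

HB.instance Definition _ := Choice.on local_space.
HB.instance Definition _ : EqQuotient _ dloc_zero local_space :=
  EqQuotient.on local_space.
HB.instance Definition _ :=
  isPointed.Build local_space (\pi_local_space (point : rooted_graph L T)).

Definition local_dist (x y : local_space) : R := dloc (repr x) (repr y).

Lemma local_dist_xx x : local_dist x x = 0.
Proof. exact: dloc_xx. Qed.

Lemma local_dist_eq0 x y : local_dist x y = 0 -> x = y.
Proof.
by move=> /eqP xy; rewrite -[x]reprK -[y]reprK; exact/eqmodP.
Qed.

Lemma local_dist_sym x y : local_dist x y = local_dist y x.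
Proof. exact: dloc_sym. Qed.

Lemma local_dist_triangle y x z : local_dist x z <= local_dist x y + local_dist y z.
Proof. exact: dloc_triangle. Qed.

HB.instance Definition _ := isMetric.Build R local_space
  local_dist_xx local_dist_eq0 local_dist_sym local_dist_triangle.

Definition rooted_class (g : rooted_graph L T) : local_space := \pi_local_space g.

Lemma local_dist_class g h : mdist (rooted_class g) (rooted_class h) = dloc g h.
Proof.
have reprP k : dloc (repr (rooted_class k)) k = 0.
  by apply/eqP/(eqquotP local_space); rewrite reprK.
rewrite [LHS]/(dloc _ _); apply/eqP; rewrite eq_le; apply/andP; split.
- rewrite (le_trans (dloc_triangle g _ _))// reprP add0r.
  by rewrite (le_trans (dloc_triangle h _ _))// (dloc_sym h) reprP addr0.
- rewrite (le_trans (dloc_triangle (repr (rooted_class g)) _ _))//.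
  rewrite dloc_sym reprP add0r.
  by rewrite (le_trans (dloc_triangle (repr (rooted_class h)) _ _))// reprP addr0.
Qed.

End local_metric.

Section empirical_law.
Variables (R : realType) (L : {nonneg R}) (T : polishType R).

Definition rooted_at n (G : network L T n) (i : 'I_n) : borel (local_space L T) :=
  rooted_class (rooted_network G i).

Definition empirical_law n (G : network L T n.+1) :
    {measure set (borel (local_space L T)) -> \bar R} :=
  mscale (n.+1%:R^-1)%:nng
    (msum (fun k => dirac (rooted_at G (inord k))) n.+1).

End empirical_law.

Section convergence.
Variables (R : realType) (d : nat -> measure_display).
Variables (Omega : forall n, measurableType (d n)).
Variable Pr : forall n, probability (Omega n) R.

Definition cvg_in_probability (X : forall n, Omega n -> R) (c : R) :=
  forall e : R, 0 < e ->
    Pr n [set w | e <= `|X n w - c|] @[n --> \oo] --> 0%E.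

Definition cvg_in_distribution (X : forall n, Omega n -> R)
    d' (Omega' : measurableType d') (Q : probability Omega' R) (Y : Omega' -> R) :=
  forall h : R -> R, continuous h -> bounded_fun h ->
    ('E_(Pr n)[h \o X n])%E @[n --> \oo] --> ('E_Q[h \o Y])%E.

End convergence.

(* Main.v *)
Require Import Defs.
From mathcomp Require Import all_boot all_order all_algebra.
From mathcomp Require Import finmap ring lra.
From mathcomp Require Import all_classical all_reals all_analysis.
From mathcomp Require Import measurable_realfun.

Set Implicit Arguments.
Unset Strict Implicit.
Unset Printing Implicit Defensive.

Import Order.TTheory GRing.Theory Num.Theory.
Import numFieldTopology.Exports numFieldNormedType.Exports.

Local Open Scope classical_set_scope.
Local Open Scope ring_scope.

(** Each vertex averages its out-neighbours with weights that sum to at most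
    one and then applies an L-Lipschitz response, so the equilibrium map contracts
    bounded configurations by the factor L < 1. Iterating it k times from the zero
    configuration therefore approximates the equilibrium within L^k times a
    constant that depends only on L and a bound M on the shocks
    ([mark_iter_equilibrium_le]), and the same contraction gives existence and
    uniqueness of bounded equilibria ([exists_unique_bounded_equilibrium]).

    The k-th iterate at the root only reads the ball of radius k, so it is a
    continuous function for the local topology ([local_iter_continuous]). The
    average over the vertices of a finite network of a bounded continuous function
    of this iterate is an integral against the empirical law
    ([empirical_integral]), and local convergence sends it to the corresponding
    integral against the limiting law.

    Two points remain. First, the approximation is uniform only on networks with
    bounded shocks. By Markov's inequality the shocks of the finite networks are at
    most M with a probability close to one when M is large ([shock_tail]), and the
    exceptional networks are discarded. Secondly, the limiting network must have
    bounded shocks as well. Choose M so large that the n-th network has all shocks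
    below M with probability bounded away from zero. Another recursion of the same
    kind, [add_excess], accumulates the excesses of the shocks over M along
    directed paths; it is continuous in the local topology, and the empirical
    integral of its truncation at 1 vanishes on networks with shocks at most M. The
    limit in probability is deterministic, so it is zero, and almost every limiting forward component
    has shocks at most M ([limit_shocks_bounded]).

    Together these give convergence of the averages of every bounded continuous
    function of the equilibrium ([equilibrium_average_cvg]). Evaluating at an
    independent uniform vertex replaces the average by an expectation, and bounded
    convergence in probability implies convergence of expectations
    ([equilibrium_cvg_in_distribution]). *)

(** * Iterating maps driven by the marks *)

Section recursion.
Variables (R : realType) (L : {nonneg R}) (T : polishType R).

Definition weighted_mean (V : choiceType) (G : mgraph L T V) (x : V -> R) (v : V) : R :=
  \sum_(u \in edge G v) weight G v u * x u.

(** The vertex map Phi is a parameter because two recursions are needed: [respond]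
    for the equilibrium, and [add_excess] for a bound on the shocks. *)
Fixpoint mark_iter (Phi : vertex_mark L T -> R -> R) (V : choiceType)
    (G : mgraph L T V) (k : nat) (v : V) : R :=
  if k is j.+1 then Phi (mark G v) (weighted_mean G (mark_iter Phi G j) v) else 0.

Definition respond (m : vertex_mark L T) (z : R) : R := vresp m (z + vshock m).

(** All iterates of this map are nonnegative, and since the weights of edges are
    positive, the root value vanishes at every depth exactly when no vertex that
    the root can reach has a shock larger than M in absolute value. *)
Definition add_excess (M : R) (m : vertex_mark L T) (z : R) : R :=
  z + Num.max 0 (`|vshock m| - M).

Section one_graph.
Variables (V : choiceType) (G : mgraph L T V).

Lemma weight_ge0 v u : 0 <= weight G v u.
Proof.
rewrite /weight; case: ifP => // _; apply: divr_ge0 => //.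
by apply: fsumr_ge0 => w _.
Qed.

Lemma exposure_sum_gt0 v u : edge G v u ->
  0 < \sum_(w \in edge G v) (exposure G v w)%:num.
Proof.
move=> vu; rewrite (fsbigD1 u)//=; last exact: out_finite.
by apply: ltr_pwDl => //; apply: fsumr_ge0.
Qed.

Lemma weight_gt0 v u : edge G v u -> 0 < weight G v u.
Proof.
by move=> vu; rewrite /weight asboolT// divr_gt0// (exposure_sum_gt0 vu).
Qed.

Lemma weight_sum_le1 v : \sum_(u \in edge G v) weight G v u <= 1.
Proof.
have [-> |/set0P[u vu]] := eqVneq (edge G v) set0; first by rewrite fsbig_set0.
have S0 := exposure_sum_gt0 vu.
rewrite (eq_fsbigr (fun u => (exposure G v u)%:num *
  (\sum_(w \in edge G v) (exposure G v w)%:num)^-1)); last first.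
  by move=> w; rewrite inE => vw; rewrite /weight asboolT.
rewrite fsbig_finite; last exact: out_finite.
rewrite -mulr_suml -fsbig_finite; last exact: out_finite.
by rewrite mulfV// gt_eqF.
Qed.

Lemma norm_weighted_mean_le (x : V -> R) v B : 0 <= B ->
  (forall u, edge G v u -> `|x u| <= B) -> `|weighted_mean G x v| <= B.
Proof.
move=> B0 xB; rewrite /weighted_mean.
apply: (@le_trans _ _ (\sum_(u \in edge G v) weight G v u * B)).
  rewrite !fsbig_finite; [|exact: out_finite..].
  apply: le_trans (ler_norm_sum _ _ _) _; rewrite !big_seq.
  apply: ler_sum => u; rewrite in_fset_set; last exact: out_finite.
  rewrite inE => vu; rewrite normrM ger0_norm ?weight_ge0// ler_wpM2l ?weight_ge0//.
  exact: xB.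
rewrite fsbig_finite; last exact: out_finite.
rewrite -mulr_suml -fsbig_finite; last exact: out_finite.
by rewrite -[leRHS]mul1r ler_wpM2r// weight_sum_le1.
Qed.

Lemma weighted_meanB (x y : V -> R) v :
  weighted_mean G x v - weighted_mean G y v = weighted_mean G (fun u => x u - y u) v.
Proof.
rewrite /weighted_mean !fsbig_finite; [|exact: out_finite..].
by rewrite -sumrB; apply: eq_bigr => u _; rewrite mulrBr.
Qed.

Lemma respond_contraction (x y : V -> R) v B : 0 <= B ->
  (forall u, edge G v u -> `|x u - y u| <= B) ->
  `|respond (mark G v) (weighted_mean G x v) -
    respond (mark G v) (weighted_mean G y v)| <= L%:num * B.
Proof.
move=> B0 xyB; apply: le_trans (response_lipschitz _ _ _) _.
rewrite ler_wpM2l// opprD addrACA subrr addr0 weighted_meanB.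
exact: norm_weighted_mean_le.
Qed.

Lemma norm_respond_le m z : `|respond m z| <= L%:num * (`|z| + `|vshock m|).
Proof.
rewrite /respond -[vresp m _]subr0 -(response0 (vresp m)).
apply: le_trans (response_lipschitz _ _ _) _.
by rewrite ler_wpM2l// subr0 ler_normD.
Qed.

Section bounded_shocks.
Variables (M : R).
Hypotheses (L1 : L%:num < 1) (M0 : 0 <= M).
Hypothesis shockM : forall v, `|vshock (mark G v)| <= M.

(** The fixed point of B = L (B + M), hence the radius of a ball that the
    equilibrium map preserves. *)
Definition equilibrium_bound := L%:num * M / (1 - L%:num).

Lemma equilibrium_bound_ge0 : 0 <= equilibrium_bound.
Proof. by rewrite divr_ge0// ?mulr_ge0// subr_ge0 ltW. Qed.

Lemma equilibrium_boundE : L%:num * (equilibrium_bound + M) = equilibrium_bound.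
Proof.
rewrite /equilibrium_bound; move: L1; set l := L%:num => l1.
by field; rewrite subr_eq0 gt_eqF.
Qed.

Lemma norm_mark_iter_le k v : `|mark_iter respond G k v| <= equilibrium_bound.
Proof.
elim: k v => [|k IH] v; first by rewrite normr0 equilibrium_bound_ge0.
rewrite -equilibrium_boundE; apply: le_trans (norm_respond_le _ _) _.
rewrite ler_wpM2l// lerD// norm_weighted_mean_le//.
exact: equilibrium_bound_ge0.
Qed.

(** The (k + m)-th and k-th iterates are the images under k contractions of the
    m-th iterate and of zero, which differ by at most the equilibrium bound. *)
Lemma mark_iterB_le k m v :
  `|mark_iter respond G (k + m) v - mark_iter respond G k v|
    <= L%:num ^+ k * equilibrium_bound.
Proof.
elim: k v => [|k IH] v; first by rewrite subr0 mul1r norm_mark_iter_le.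
rewrite exprS -mulrA; apply: respond_contraction => //.
by rewrite mulr_ge0 ?exprn_ge0 ?equilibrium_bound_ge0.
Qed.

(** Any bound K on y improves to L^j K + equilibrium_bound after j uses of the
    equilibrium equation; then j tends to infinity. *)
Lemma norm_equilibrium_le (y : V -> R) : is_equilibrium G y -> bounded_fun y ->
  forall v, `|y v| <= equilibrium_bound.
Proof.
move=> eqy bdy v.
have [K K0 yK] : exists2 K, 0 <= K & forall v, `|y v| <= K.
  case: bdy => K [_ /(_ (`|K| + 1))]; rewrite (le_lt_trans (ler_norm _))?ltrDl// => h.
  by exists (`|K| + 1) => [|w]; [rewrite addr_ge0|exact: h].
have step j : forall w, `|y w| <= L%:num ^+ j * K + equilibrium_bound.
  elim: j => [|j IH] w.
    by rewrite mul1r (le_trans (yK w))// lerDl equilibrium_bound_ge0.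
  rewrite eqy; apply: le_trans (norm_respond_le _ _) _.
  apply: (@le_trans _ _ (L%:num * ((L%:num ^+ j * K + equilibrium_bound) + M))).
    rewrite ler_wpM2l// lerD// norm_weighted_mean_le//.
    by rewrite addr_ge0 ?equilibrium_bound_ge0 ?mulr_ge0 ?exprn_ge0.
  by rewrite -addrA mulrDr equilibrium_boundE exprS mulrA.
have cv : (L%:num ^+ j * K + equilibrium_bound) @[j --> \oo] -->
    0 * K + equilibrium_bound.
  apply: cvgD; last exact: cvg_cst.
  by apply: cvgMr_tmp; apply: cvg_expr; rewrite ger0_norm.
rewrite mul0r add0r in cv; apply: (cvgr_to_ge cv).
by near=> j; exact: step.
Unshelve. all: by end_near. Qed.

Lemma mark_iter_equilibrium_le (y : V -> R) : is_equilibrium G y -> bounded_fun y ->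
  forall k v, `|y v - mark_iter respond G k v| <= L%:num ^+ k * equilibrium_bound.
Proof.
move=> eqy bdy; elim=> [|k IH] v; first by rewrite subr0 mul1r norm_equilibrium_le.
rewrite exprS -mulrA eqy; apply: respond_contraction => //.
by rewrite mulr_ge0 ?exprn_ge0 ?equilibrium_bound_ge0.
Qed.

Lemma cvg_rate0 : (L%:num ^+ k * equilibrium_bound) @[k --> \oo] --> (0 : R).
Proof.
rewrite -[X in _ --> X](mul0r equilibrium_bound).
by apply: cvgMr_tmp; apply: cvg_expr; rewrite ger0_norm.
Qed.

Lemma mark_iter_cvg_equilibrium (y : V -> R) : is_equilibrium G y -> bounded_fun y ->
  forall v, mark_iter respond G ^~ v @ \oo --> y v.
Proof.
move=> eqy bdy v; apply/cvgrPdist_le => e e0.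
have /cvgrPdist_le/(_ e e0) := cvg_rate0.
apply: filterS => k; rewrite sub0r normrN ger0_norm; last first.
  by rewrite mulr_ge0 ?exprn_ge0 ?equilibrium_bound_ge0.
by apply: le_trans; exact: mark_iter_equilibrium_le.
Qed.

End bounded_shocks.
End one_graph.
End recursion.
(** * Existence and uniqueness of bounded equilibria *)

Lemma cvg_fsum (R : realType) (V : choiceType) (A : set V) (x : nat -> V -> R) (y : V -> R) :
  finite_set A -> (forall u, A u -> x n u @[n --> \oo] --> y u) ->
  \sum_(u \in A) x n u @[n --> \oo] --> \sum_(u \in A) y u.
Proof.
move=> finA xy; rewrite fsbig_finite//.
rewrite (_ : (fun n => _) = (fun n => \sum_(u <- fset_set A) x n u)); last first.
  by apply/funext => n; rewrite fsbig_finite.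
rewrite big_seq; under eq_fun do rewrite big_seq.
apply: cvg_big => [|u]; first exact: add_continuous.
by rewrite in_fset_set// inE; exact: xy.
Qed.

Section equilibrium_existence.
Variables (R : realType) (L : {nonneg R}) (T : polishType R).
Variables (V : choiceType) (G : mgraph L T V) (M : R).
Hypotheses (L1 : L%:num < 1) (M0 : 0 <= M).
Hypothesis shockM : forall v, `|vshock (mark G v)| <= M.

Lemma mark_iter_cvg v : cvgn (mark_iter (@respond R L T) G ^~ v).
Proof.
apply: cauchy_cvg; apply: cauchy_exP => e e0.
have /cvgrPdist_lt/(_ e e0) := cvg_rate0 M L1.
case=> N _ /(_ N (leqnn N)); rewrite sub0r normrN => rateN.
exists (mark_iter (@respond R L T) G N v), N => // n /= Nn.
rewrite /ball/= distrC -(subnKC Nn); apply: le_lt_trans rateN.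
by apply: le_trans (mark_iterB_le L1 M0 shockM _ _ _) (ler_norm _).
Qed.

(** The equilibrium map contracts bounded configurations by the factor L, since
    the weights of each vertex sum to at most one. *)
Lemma exists_unique_bounded_equilibrium :
  exists! y : V -> R, bounded_fun y /\ is_equilibrium G y.
Proof.
pose B := equilibrium_bound L M.
pose y v := limn (mark_iter (@respond R L T) G ^~ v).
have cvy v : mark_iter (@respond R L T) G ^~ v @ \oo --> y v by exact: mark_iter_cvg.
exists y; split; [split|] => [||z [bz ez]].
- exists B; split=> [|K BK v _]; first exact: num_real.
  apply: le_trans (ltW BK); rewrite ler_norml; apply/andP; split.
    apply: (cvgr_to_ge (cvy v)); near=> k.
    by have /ler_normlP[] := norm_mark_iter_le L1 M0 shockM k v; rewrite lerNl.
  apply: (cvgr_to_le (cvy v)); near=> k.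
  by have /ler_normlP[] := norm_mark_iter_le L1 M0 shockM k v.
- move=> v; apply: (cvg_unique _ (cvy v)) => //.
  rewrite /= -(cvg_shiftS (mark_iter (@respond R L T) G ^~ v)).
  apply: (@continuous_cvg _ _ _ \oo _ _ (vresp (mark G v))); first exact: response_continuous.
  apply: cvgD; last exact: cvg_cst.
  apply: cvg_fsum; first exact: out_finite.
  by move=> u _; apply: cvgMl_tmp; exact: cvy.
- apply/funext => v; apply: (cvg_unique _ (cvy v)) => //.
  exact: (mark_iter_cvg_equilibrium L1 M0 shockM ez bz).
Unshelve. all: by end_near. Qed.

End equilibrium_existence.
(** * Restriction to balls and forward components *)

Section transport.
Variables (R : realType) (L : {nonneg R}) (T : polishType R).

Lemma weighted_meanE (V : choiceType) (G : mgraph L T V) (x : V -> R) v :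
  weighted_mean G x v = (\sum_(u \in edge G v) (exposure G v u)%:num * x u) /
                        (\sum_(u \in edge G v) (exposure G v u)%:num).
Proof.
rewrite /weighted_mean (eq_fsbigr (fun u => (exposure G v u)%:num * x u /
  (\sum_(w \in edge G v) (exposure G v w)%:num))); last first.
  by move=> u; rewrite inE => vu; rewrite /weight asboolT// mulrAC.
rewrite fsbig_finite; last exact: out_finite.
by rewrite -mulr_suml -fsbig_finite//; exact: out_finite.
Qed.

Lemma weighted_mean_embed (V W : choiceType) (G : mgraph L T V) (H : mgraph L T W)
    (f : W -> V) (x : W -> R) (y : V -> R) (w : W) :
  injective f -> edge G (f w) = f @` edge H w ->
  (forall u, exposure H w u = exposure G (f w) (f u)) ->
  (forall u, edge H w u -> x u = y (f u)) ->
  weighted_mean H x w = weighted_mean G y (f w).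
Proof.
move=> f_inj eG ce xy; rewrite !weighted_meanE.
have bij : set_bij (edge H w) (edge G (f w)) f.
  split; first by rewrite eG => u; exists u.
    by move=> u u' _ _; exact: f_inj.
  by rewrite eG.
rewrite !(reindex_fsbig _ _ _ _ bij); congr (_ / _).
  by apply: eq_fsbigr => u; rewrite inE => wu; rewrite xy// ce.
by apply: eq_fsbigr => u _; rewrite ce.
Qed.

(** The k-th iterate only looks k edges ahead. The intended reading of D k w is that
    the first k steps from w are the same in H and in G. *)
Lemma mark_iter_embed Phi (V W : choiceType) (G : mgraph L T V) (H : mgraph L T W)
    (f : W -> V) (D : nat -> W -> Prop) :
  injective f -> (forall w, mark H w = mark G (f w)) ->
  (forall w u, exposure H w u = exposure G (f w) (f u)) ->
  (forall k w, D k.+1 w ->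
    edge G (f w) = f @` edge H w /\ forall u, edge H w u -> D k u) ->
  forall k w, D k w -> mark_iter Phi H k w = mark_iter Phi G k (f w).
Proof.
move=> f_inj mk ce DD; elim=> [//|k IH] w /DD[eG Du] /=.
rewrite mk; congr (Phi _ _); apply: weighted_mean_embed => //.
by move=> u /Du /IH.
Qed.

(** The vertices of a rooted graph form a bare type; sums over out-neighbours
    require the classical choice structure. *)
Definition classic_graph (g : rooted_graph L T) : mgraph L T {classic vertex g} :=
  graph g.

Definition root_iter Phi k (g : rooted_graph L T) : R :=
  mark_iter Phi (classic_graph g) k (groot g).

Lemma walk_rcons (V : Type) (e : V -> V -> Prop) n (a b c : V) :
  walk e n a b -> e b c -> walk e n.+1 a c.
Proof.
elim: n a => [|n IH] a /= => [->|[w aw wb]] bc; first by exists c.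
by exists w => //; exact: IH.
Qed.

Lemma root_iter_ball Phi k (g : rooted_graph L T) :
  root_iter Phi k (ball_graph k g) = root_iter Phi k g.
Proof.
rewrite /root_iter.
pose D j (v : {classic vertex (ball_graph k g)}) :=
  (j <= k)%N /\ dplus_le g (k - j) (sval v).
rewrite (@mark_iter_embed Phi {classic vertex g} {classic vertex (ball_graph k g)}
  (classic_graph g) (classic_graph (ball_graph k g)) (@sval _ _) D)//.
- exact: sval_inj.
- move=> j v [jk [n nk wn]].
  (* Some walk of length at most k - j - 1 reaches v, so the ball of radius k
     keeps all out-edges of v and their targets have j steps left. *)
  have nlt : (n < k)%N by rewrite (leq_ltn_trans nk)// ltn_subrL (leq_trans _ jk).
  have vlt : dplus_lt g k (sval v) by exists n.
  have ule u : edge g (sval v) u -> dplus_le g (k - j) u.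
    by move=> vu; exists n.+1; [rewrite -(subnSK jk) ltnS|exact: walk_rcons vu].
  split; last first.
    by move=> u [vu _]; split; [exact: ltnW|exact: ule].
  apply/seteqP; split=> [u vu|_ [u [vu _] <-]//].
  have uk : dplus_le g k u.
    by case: (ule _ vu) => m mk wm; exists m => //; rewrite (leq_trans mk)// leq_subr.
  by exists (exist _ u uk) => //; split.
- by split=> //; exists 0%N.
Qed.

Lemma root_iter_forward_component Phi k (g : rooted_graph L T) :
  root_iter Phi k (forward_component g) = root_iter Phi k g.
Proof.
rewrite /root_iter (@mark_iter_embed Phi {classic vertex g}
  {classic vertex (forward_component g)} (classic_graph g)
  (classic_graph (forward_component g)) (@sval _ _) (fun _ _ => True))//.
- exact: sval_inj.
- move=> j [v [r [n nr wn]]] _; split=> //.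
  apply/seteqP; split=> [u vu|_ [u vu <-]//].
  have ru : reachable u by exists n.+1, n.+1 => //; exact: walk_rcons wn vu.
  by exists (exist _ u ru).
Qed.

Lemma root_iter_rooted_network Phi k n (G : network L T n) i :
  root_iter Phi k (rooted_network G i) = mark_iter Phi G k i.
Proof.
rewrite /root_iter (@mark_iter_embed Phi 'I_n {classic {k : nat | (k < n)%N}}
  G (classic_graph (rooted_network G i)) (@ordinal_of n) (fun _ _ => True))//.
- by congr (mark_iter _ _ _ _); apply: val_inj.
- exact: ordinal_of_inj.
- move=> j w _; split=> //; apply/seteqP; split=> [u vu|_ [u vu <-]//].
  have uE : ordinal_of (exist _ (val u) (ltn_ord u)) = u by exact: val_inj.
  by exists (exist _ (val u) (ltn_ord u)) => //=; rewrite uE.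
Qed.

End transport.
(** * Convergence of marks *)

Section local_continuity.
Variables (R : realType) (L : {nonneg R}) (T : polishType R).

Lemma wsum_ge_term (u : nat -> R) r : (forall r, 0 <= u r <= 1) ->
  2^-1 ^+ r.+1 * u r <= wsum u.
Proof.
move=> u01; have cu := wsum_cvg u01.
have tge0 k : 0 <= 2^-1 ^+ k.+1 * u k.
  by apply: mulr_ge0; [exact: exprn_ge0|by case/andP: (u01 k)].
have nd : nondecreasing_seq (series (fun r => 2^-1 ^+ r.+1 * u r)).
  by apply/nondecreasing_seqP => n; rewrite seriesSr lerDl.
apply: le_trans (nondecreasing_cvgn_le nd cu r.+1).
by rewrite seriesSr lerDr /series/= sumr_ge0.
Qed.

Lemma cvg_squeeze0 (a b : nat -> R) : (forall n, 0 <= a n) ->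
  (\forall n \near \oo, a n <= b n) -> b @ \oo --> 0 -> a @ \oo --> 0.
Proof.
move=> a0 ab b0; apply: (squeeze_cvgr _ (cvg_cst 0) b0).
by apply: filterS ab => n ->; rewrite a0.
Qed.

Lemma cvg_term_wsum (u : nat -> nat -> R) r : (forall n r, 0 <= u n r <= 1) ->
  wsum (u n) @[n --> \oo] --> 0 -> u n r @[n --> \oo] --> 0.
Proof.
move=> u01 su; have p0 : 0 < 2^-1 ^+ r.+1 :> R by rewrite exprn_gt0// invr_gt0.
apply: (@cvg_squeeze0 _ (fun n => (2^-1 ^+ r.+1)^-1 * wsum (u n))).
- by move=> n; case/andP: (u01 n r).
- by apply: nearW => n; rewrite ler_pdivlMl// wsum_ge_term.
- by rewrite -[X in _ --> X](mulr0 (2^-1 ^+ r.+1)^-1); apply: cvgMl_tmp.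
Qed.

Lemma cvg_min1 (a : nat -> R) : (forall n, 0 <= a n) ->
  Num.min 1 (a n) @[n --> \oo] --> 0 -> a @ \oo --> 0.
Proof.
move=> a0 ma; apply: (cvg_squeeze0 a0 _ ma).
have : \forall n \near \oo, Num.min 1 (a n) < 1.
  by apply: (cvgr_lt _ ma).
by apply: filterS => n; rewrite gt_min ltxx/= => an; rewrite le_min lexx ltW.
Qed.

(** Split f_n(z_n) - f(z) at f_n(z): the Lipschitz constant is uniform in n, and
    the metric on responses controls the distance of f_n and f on a fixed compact
    interval that contains z. *)
Lemma cvg_response (f : response L) (f_ : nat -> response L) z (z_ : nat -> R) :
  mdist f (f_ n) @[n --> \oo] --> 0 -> z_ @ \oo --> z ->
  f_ n (z_ n) @[n --> \oo] --> f z.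
Proof.
move=> ff zz; pose q := Num.bound `|z|.
have zq : `|z| <= q.+1%:R.
  by apply: le_trans (ltW (archi_boundP (normr_ge0 z))) _; rewrite ler_nat.
have sup0 : sup_dist_on q.+1 f (f_ n) @[n --> \oo] --> 0.
  apply: cvg_min1 => [n|]; first exact: sup_dist_on_ge0.
  apply: (@cvg_term_wsum (fun n r => Num.min 1 (sup_dist_on r.+1 f (f_ n)))) => // n r.
  by rewrite min1_01// sup_dist_on_ge0.
apply/subr_cvg0/norm_cvg0P.
apply: (@cvg_squeeze0 _ (fun n => L%:num * `|z_ n - z| + sup_dist_on q.+1 f (f_ n))) => //.
  apply: nearW => n; apply: le_trans (ler_distD (f_ n z) _ _) _.
  by apply: lerD; [exact: response_lipschitz|rewrite distrC; exact: sup_dist_on_ubound].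
rewrite -[X in _ --> X](addr0 0); apply: cvgD => //.
rewrite -[X in _ --> X](mulr0 L%:num); apply: cvgMl_tmp.
by apply/norm_cvg0P/subr_cvg0.
Qed.

(** Sequential form, which suffices since every space of interest is metric. *)
Definition jointly_continuous (Phi : vertex_mark L T -> R -> R) :=
  forall m (m_ : nat -> vertex_mark L T) z (z_ : nat -> R),
    mdist m (m_ n) @[n --> \oo] --> 0 -> z_ @ \oo --> z ->
    Phi (m_ n) (z_ n) @[n --> \oo] --> Phi m z.

Lemma cvg_shock (m : vertex_mark L T) (m_ : nat -> vertex_mark L T) :
  mdist m (m_ n) @[n --> \oo] --> 0 -> vshock (m_ n) @[n --> \oo] --> vshock m.
Proof.
move=> mm; apply/subr_cvg0/norm_cvg0P.
apply: (cvg_squeeze0 _ _ mm) => //; apply: nearW => n.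
by rewrite distrC /mdist/= /vertex_mark_dist !le_max lexx orbT.
Qed.

Lemma respond_continuous : jointly_continuous (@respond R L T).
Proof.
move=> m m_ z z_ mm zz; apply: cvg_response; last by apply: cvgD => //; exact: cvg_shock.
apply: (cvg_squeeze0 _ _ mm) => [n|]; first exact: mdist_ge0.
by apply: nearW => n; rewrite {2}/mdist/= /vertex_mark_dist !le_max lexx !orbT.
Qed.

Lemma add_excess_continuous M : jointly_continuous (@add_excess R L T M).
Proof.
move=> m m_ z z_ mm zz; apply: cvgD => //.
apply: (@continuous_cvg _ _ _ \oo _ _ (fun e => Num.max 0 (`|e| - M))); last exact: cvg_shock.
apply: continuous_max; first exact: cvg_cst.
by apply: cvgB; [exact: cvg_norm|exact: cvg_cst].
Qed.

(** The metric on exposures compares logarithms, and exp is continuous. *)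
Lemma cvg_exposure (c : {posnum R}) (c_ : nat -> {posnum R}) :
  edge_dist1 c (c_ n) @[n --> \oo] --> 0 -> (c_ n)%:num @[n --> \oo] --> c%:num.
Proof.
move=> /cvg_min1 cc.
have lncv : ln (c_ n)%:num @[n --> \oo] --> ln c%:num.
  by apply/subr_cvg0/norm_cvg0P; under eq_fun do rewrite distrC; exact: cc.
rewrite -[X in _ --> X]lnK ?posrE//.
rewrite (_ : (fun n => _) = (expR \o (fun n => ln (c_ n)%:num))); last first.
  by apply/funext => n /=; rewrite lnK ?posrE.
by apply: continuous_cvg lncv; exact: continuous_expR.
Qed.

End local_continuity.
(** * Continuity of the iterates in the local topology *)

(** If f is discontinuous at x, then points within 1/(n+1) of x whose values stay
    away from f x form a sequence that contradicts the hypothesis. *)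
Lemma metric_seq_continuous (R : realType) (X : metricType R) (f : X -> R) (x : X) :
  (forall x_ : nat -> X, mdist x (x_ n) @[n --> \oo] --> 0 ->
     f (x_ n) @[n --> \oo] --> f x) ->
  {for x, continuous f}.
Proof.
move=> seqf; apply/(@cvgrPdist_lt R R^o _ (nbhs x) (nbhs_filter x)) => e e0.
apply: contrapT => far.
have ex n : exists y : X, mdist x y < n.+1%:R^-1 /\ e <= `|f x - f y|.
  apply: contrapT => /forallNP nex; apply: far.
  apply/nbhs_ballP; exists n.+1%:R^-1 => /=; first by rewrite invr_gt0.
  move=> y; rewrite ballEmdist /= => xy; rewrite ltNge; apply/negP => le.
  by apply: (nex y).
have [y yP] := choice ex.
have cv : mdist x (y n) @[n --> \oo] --> (0 : R).
  apply: (cvg_squeeze0 _ _ (@cvg_harmonic R)) => [n|]; first exact: mdist_ge0.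
  by apply: nearW => n; apply: ltW; case: (yP n).
have /cvgrPdist_lt/(_ e e0)[N _ /(_ N (leqnn N))] := seqf _ cv.
by rewrite ltNge; case: (yP N) => _ ->.
Qed.

Section iterate_continuity.
Variables (R : realType) (L : {nonneg R}) (T : polishType R).
Implicit Types g : rooted_graph L T.

(** The isomorphisms identify all out-neighbourhoods with that of the limit, so
    each step is a fixed finite sum and a quotient of convergent exposures. A
    vertex without out-edges is treated apart, because its quotient is 0 / 0. *)
Lemma mark_iter_cvg_iso Phi g (h : nat -> rooted_graph L T)
    (phi : forall n, vertex g -> vertex (h n)) :
  jointly_continuous Phi -> (forall n, root_iso g (h n) (phi n)) ->
  mark_discrepancy (phi n) @[n --> \oo] --> (0 : R) ->
  forall k (v : {classic vertex g}),
    mark_iter Phi (classic_graph (h n)) k (phi n v) @[n --> \oo] -->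
    mark_iter Phi (classic_graph g) k v.
Proof.
move=> cPhi iso disc; elim=> [|k IH] v /=; first exact: cvg_cst.
apply: cPhi.
  apply: cvg_min1 => [n|]; first exact: mdist_ge0.
  apply: (cvg_squeeze0 _ _ disc) => [n|].
    by rewrite le_min ler01 mdist_ge0.
  by apply: nearW => n; exact: vertex_dist1_le_discrepancy.
have [g0|/set0P[u0 vu0]] := eqVneq (edge (classic_graph g) v) set0.
  rewrite {2}/weighted_mean g0 fsbig_set0.
  rewrite (_ : (fun n => _) = fun=> 0); first exact: cvg_cst.
  apply/funext => n; rewrite /weighted_mean.
  rewrite (_ : edge _ _ = set0) ?fsbig_set0//.
  have [[psi phiK psiK] _ phie] := iso n.
  apply/seteqP; split=> // w vw.
  have : edge (classic_graph g) v (psi w) by apply/phie; rewrite psiK.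
  by rewrite g0.
have bij n : set_bij (edge (classic_graph g) v : set {classic vertex g})
    (edge (classic_graph (h n)) (phi n v) : set {classic vertex (h n)}) (phi n).
  have [[psi phiK psiK] _ phie] := iso n; split.
  - by move=> u /phie.
  - by move=> u u' _ _; exact: (can_inj phiK).
  - by move=> w vw; exists (psi w); [apply/phie; rewrite psiK|exact: psiK].
have expo u : edge (classic_graph g) v u ->
    (exposure (h n) (phi n v) (phi n u))%:num @[n --> \oo] -->
    (exposure g v u)%:num.
  move=> vu; apply: cvg_exposure; apply: (cvg_squeeze0 _ _ disc) => [n|].
    by rewrite le_min ler01/=.
  by apply: nearW => n; exact: edge_dist1_le_discrepancy.
rewrite weighted_meanE.
rewrite (_ : (fun n => _) = fun n =>
  (\sum_(u \in edge (classic_graph g) v) (exposure (h n) (phi n v) (phi n u))%:num *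
     mark_iter Phi (classic_graph (h n)) k (phi n u)) /
  (\sum_(u \in edge (classic_graph g) v) (exposure (h n) (phi n v) (phi n u))%:num));
  last first.
  by apply/funext => n; rewrite weighted_meanE !(reindex_fsbig _ _ _ _ (bij n)).
apply: cvgM; last apply: cvgV.
- apply: cvg_fsum; first exact: out_finite.
  by move=> u vu; apply: cvgM; [exact: expo|exact: IH].
- by rewrite gt_eqF// (exposure_sum_gt0 vu0).
- by apply: cvg_fsum => //; exact: out_finite.
Qed.

(** An infimum over isomorphisms is approached up to any e > 0, which avoids
    showing that it is attained. *)
Lemma near_root_iso g h e : rooted_dist g h < 1 -> 0 < e ->
  exists2 phi, root_iso g h phi & mark_discrepancy phi < rooted_dist g h + e.
Proof.
move=> d1 e0; have [ne|/rooted_dist_noniso d] := pselect (root_iso g h !=set0); last first.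
  by rewrite d ltxx in d1.
apply: contrapT => nex.
suff : rooted_dist g h + e <= rooted_dist g h by rewrite gerDl leNgt e0.
apply: le_rooted_dist => // phi iphi; rewrite leNgt; apply/negP => lt.
by apply: nex; exists phi.
Qed.

(** Closeness at radius k produces isomorphisms of the k-balls whose mark
    discrepancies vanish, and the k-th iterate at the root only depends on the
    k-ball. *)
Lemma root_iter_cvg Phi k g (h : nat -> rooted_graph L T) :
  jointly_continuous Phi -> dloc g (h n) @[n --> \oo] --> 0 ->
  root_iter Phi k (h n) @[n --> \oo] --> root_iter Phi k g.
Proof.
move=> cPhi gh.
have rd : rooted_dist (ball_graph k g) (ball_graph k (h n)) @[n --> \oo] --> (0 : R).
  apply: (@cvg_term_wsum _ (fun n r => rooted_dist (ball_graph r g) (ball_graph r (h n)))).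
    by move=> n r; exact: rooted_dist01.
  exact: gh.
have [N _ rdN] : \forall n \near \oo,
    rooted_dist (ball_graph k g) (ball_graph k (h n)) < 1.
  by apply: (cvgr_lt _ rd).
(* Isomorphisms of the k-balls are guaranteed only once their distance is below 1. *)
rewrite -(cvg_shiftn N (fun n => root_iter Phi k (h n))).
have ex n : exists2 phi, root_iso (ball_graph k g) (ball_graph k (h (n + N)%N)) phi &
    mark_discrepancy phi <
      rooted_dist (ball_graph k g) (ball_graph k (h (n + N)%N)) + n.+1%:R^-1.
  by apply: near_root_iso => //; apply: rdN => /=; exact: leq_addl.
pose phi n := s2val (cid2 (ex n)).
have iso n : root_iso (ball_graph k g) (ball_graph k (h (n + N)%N)) (phi n).
  by rewrite /phi; case: cid2.
have disc : mark_discrepancy (phi n) @[n --> \oo] --> (0 : R).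
  apply: (@cvg_squeeze0 _ _ (fun n =>
      rooted_dist (ball_graph k g) (ball_graph k (h (n + N)%N)) + n.+1%:R^-1)).
  - by move=> n; case/andP: (discrepancy01 (phi n)).
  - by apply: nearW => n; apply: ltW; rewrite /phi; case: cid2.
  - rewrite -[X in _ --> X](addr0 0); apply: cvgD; last exact: cvg_harmonic.
    by move: rd; rewrite -(cvg_shiftn N).
have : mark_iter Phi (classic_graph (ball_graph k (h (n + N)%N))) k
      (phi n (groot (ball_graph k g))) @[n --> \oo] -->
    root_iter Phi k (ball_graph k g) by exact: mark_iter_cvg_iso.
rewrite root_iter_ball.
rewrite (_ : (fun n => _) = (fun n => root_iter Phi k (h (n + N)%N)))//.
apply/funext => n; rewrite -root_iter_ball /root_iter.
by have [_ <- _] := iso n.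
Qed.

Definition local_iter Phi k (xi : local_space L T) : R := root_iter Phi k (repr xi).

Lemma local_iter_class Phi k g : jointly_continuous Phi ->
  local_iter Phi k (rooted_class g) = root_iter Phi k g.
Proof.
move=> cPhi; have d0 : dloc g (repr (rooted_class g)) = 0.
  apply/eqP; rewrite dloc_sym; apply/(eqquotP (local_space L T)).
  by rewrite reprK.
have cv : (fun=> local_iter Phi k (rooted_class g)) @ \oo --> root_iter Phi k g.
  by apply: root_iter_cvg => //; rewrite d0; exact: cvg_cst.
by rewrite -(cvg_lim _ cv)// lim_cst.
Qed.

Lemma local_iter_continuous Phi k : jointly_continuous Phi ->
  continuous (local_iter Phi k).
Proof.
move=> cPhi xi; apply: metric_seq_continuous => eta cv.
by apply: root_iter_cvg => //; exact: cv.
Qed.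

End iterate_continuity.
(** * Measurability on finite networks *)

Section network_measurability.
Variables (R : realType) (L : {nonneg R}) (T : polishType R) (n : nat).
Local Notation net := (measurable_network L T n).

Lemma measurable_fun_gt d (X : measurableType d) (f : X -> R) :
  (forall a, measurable [set x | a < f x]) -> measurable_fun setT f.
Proof.
move=> mf; apply: (measurability _ (RGenOInfty.measurableE R)).
move=> _ [_ [a ->] <-]; rewrite setTI.
rewrite (_ : _ @^-1` _ = [set x | a < f x])//.
by apply/seteqP; split=> x /=; rewrite in_itv/= andbT.
Qed.

Lemma measurable_gt d (X : measurableType d) (f : X -> R) a :
  measurable_fun setT f -> measurable [set x | a < f x].
Proof.
move=> /(_ measurableT _ (measurable_itv `]a, +oo[)); rewrite setTI.
rewrite (_ : _ @^-1` _ = [set x | a < f x])//.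
by apply/seteqP; split=> x /=; rewrite in_itv/= andbT.
Qed.

Lemma measurable_mark i (B : set (vertex_mark L T)) : open B ->
  measurable ([set G | B (mark G i)] : set net).
Proof. by move=> oB; apply: sub_sigma_algebra; left; right; exists i, B. Qed.

Lemma measurable_fun_mark i (f : vertex_mark L T -> R) : continuous f ->
  measurable_fun setT (fun G : net => f (mark G i)).
Proof.
move=> cf; apply: measurable_fun_gt => a.
apply: (@measurable_mark i [set m | a < f m]).
by apply: (@open_comp _ _ f [set y | a < y]); [move=> ? _; exact: cf|exact: open_gt].
Qed.

Lemma measurable_fun_shock i : measurable_fun setT (fun G : net => vshock (mark G i)).
Proof.
apply: (@measurable_fun_mark i (@vshock R L T)) => m.
by apply: metric_seq_continuous => m_; exact: cvg_shock.
Qed.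

(** The sigma-algebra on networks does not see the exposure of an absent edge,
    whereas this total version is measurable. *)
Definition edge_exposure (G : network L T n) i j : R :=
  if `[< edge G i j >] then (exposure G i j)%:num else 0.

Lemma measurable_fun_edge_exposure i j :
  measurable_fun setT (fun G : net => edge_exposure G i j).
Proof.
apply: measurable_fun_gt => a; have [a0|a0] := ltP a 0.
  rewrite (_ : [set _ | _] = setT)//; apply/seteqP; split=> // G _ /=.
  by rewrite /edge_exposure; case: ifP => // _; rewrite (lt_trans a0).
rewrite (_ : [set _ | _] = [set G : network L T n | edge G i j /\
  [set c : R | a < c] (exposure G i j)%:num]).
  by apply: sub_sigma_algebra; right; exists i, j, [set c | a < c]; first exact: open_gt.
apply/seteqP; split=> G /=; rewrite /edge_exposure.
  by case: asboolP => //; rewrite ltNge a0.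
by move=> [e ac]; rewrite asboolT.
Qed.

Lemma fsum_ord (A : set 'I_n) (F : 'I_n -> R) :
  \sum_(j \in A) F j = \sum_(j < n) if j \in A then F j else 0.
Proof.
rewrite -big_mkcond/= (@bigfs _ _ _ _ (index_enum 'I_n)) ?index_enum_uniq//.
  by congr (\sum_(j \in _) F j); apply/seteqP; split=> j /=; rewrite inE.
by move=> j _; rewrite mem_index_enum.
Qed.

Lemma weighted_mean_ord (G : network L T n) x i :
  weighted_mean G x i = \sum_(j < n) weight G i j * x j.
Proof.
rewrite /weighted_mean fsum_ord; apply: eq_bigr => j _; rewrite /weight.
by case: asboolP => [e|ne]; [rewrite mem_set|rewrite memNset// mul0r].
Qed.

(** The inverse is written as a real power, which is known to be measurable. *)
Lemma weighted_mean_edge_exposure (G : network L T n) x i :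
  weighted_mean G x i = (\sum_(j < n) edge_exposure G i j * x j) *
                        (\sum_(j < n) edge_exposure G i j) `^ (-1).
Proof.
rewrite powR_inv1; last first.
  by apply: sumr_ge0 => j _; rewrite /edge_exposure; case: ifP.
rewrite weighted_meanE !fsum_ord; congr (_ / _); apply: eq_bigr => j _;
  rewrite [edge_exposure _ _ _](_ : _ =
    if j \in (edge G i : set _) then (exposure G i j)%:num else 0)//.
by case: ifP; rewrite ?mul0r.
Qed.

Lemma measurable_weighted_mean i (x : net -> 'I_n -> R) :
  (forall j, measurable_fun setT (x ^~ j)) ->
  measurable_fun setT (fun G : net => weighted_mean G (x G) i).
Proof.
move=> mx; under eq_fun do rewrite weighted_mean_edge_exposure.
apply: measurable_funM.
  apply: measurable_sum => j; apply: measurable_funM => //.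
  exact: measurable_fun_edge_exposure.
apply: (measurableT_comp (measurable_powR _)).
by apply: measurable_sum => j; exact: measurable_fun_edge_exposure.
Qed.

Definition preserves_measurability (Phi : vertex_mark L T -> R -> R) :=
  forall i (z : net -> R), measurable_fun setT z ->
    measurable_fun setT (fun G : net => Phi (mark G i) (z G)).

(** A monotone continuous f satisfies f z > a exactly when f q > a for some
    rational q < z, and f q is a continuous function of the mark. *)
Lemma respond_measurable : preserves_measurability (@respond R L T).
Proof.
move=> i z mz; apply: measurable_fun_gt => a.
have mw : measurable_fun setT (fun G : net => z G + vshock (mark G i)).
  by apply: measurable_funD => //; exact: measurable_fun_shock.
have mq (q : R) : measurable_fun setT (fun G : net => vresp (mark G i) q).
  apply: (@measurable_fun_mark i (fun m => vresp m q)) => m.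
  apply: metric_seq_continuous => m_ mm.
  apply: cvg_response; last exact: cvg_cst.
  apply: (cvg_squeeze0 _ _ mm) => [k|]; first exact: mdist_ge0.
  by apply: nearW => k; rewrite {2}/mdist/= /vertex_mark_dist !le_max lexx !orbT.
rewrite (_ : [set _ | _] = \bigcup_(q : rat)
  ([set G : net | ratr q < z G + vshock (mark G i)] `&`
   [set G : net | a < vresp (mark G i) (ratr q)])).
  apply: bigcupT_measurable_rat => q; apply: measurableI.
    exact: measurable_gt mw.
  exact: measurable_gt (mq (ratr q)).
apply/seteqP; split=> G /=; rewrite /respond; last first.
  move=> [q _ [/= qz aq]]; apply: lt_le_trans aq _.
  by apply: response_homo; exact: ltW.
set w := z G + _ => aw.
have : \forall y \near w, a < vresp (mark G i) y.
  exact: (cvgr_gt _ (@response_continuous _ _ (vresp (mark G i)) w)) _ aw.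
move=> /nbhs_ballP[e /= e0 we].
have [q] : exists q, ratr q \in `]w - e, w[.
  by apply: rat_in_itvoo; rewrite ltrBlDr ltrDl.
rewrite in_itv/= => /andP[q1 q2]; exists q => //; split=> //=.
by apply: we; rewrite /ball/= ger0_norm ?subr_ge0 ?ltW// ltrBlDr -ltrBlDl.
Qed.

Lemma add_excess_measurable M : preserves_measurability (@add_excess R L T M).
Proof.
move=> i z mz; apply: measurable_funD => //; apply: measurable_maxr => //.
apply: measurable_funB => //.
by apply: (measurableT_comp (@normr_measurable R setT)); exact: measurable_fun_shock.
Qed.

Lemma measurable_mark_iter Phi k i : preserves_measurability Phi ->
  measurable_fun setT (fun G : net => mark_iter Phi G k i).
Proof.
move=> mPhi; elim: k i => [|k IH] i /=; first exact: measurable_cst.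
by apply: mPhi; apply: measurable_weighted_mean => j; exact: IH.
Qed.

Lemma measurable_shock_norm : measurable_fun setT (fun G : net => shock_norm G).
Proof.
rewrite /shock_norm; elim: (index_enum _) => [|i s IH].
  by under eq_fun do rewrite big_nil; exact: measurable_cst.
under eq_fun do rewrite big_cons; apply: measurable_maxr => //.
by apply: (measurableT_comp (@normr_measurable R setT)); exact: measurable_fun_shock.
Qed.

End network_measurability.
(** * Equilibria of finite networks *)

Section network_equilibrium.
Variables (R : realType) (L : {nonneg R}) (T : polishType R) (n : nat).
Implicit Types G : network L T n.

Lemma network_equilibriumE G x : is_network_equilibrium G x <-> is_equilibrium G x.
Proof. by split=> eqx i; rewrite eqx ?weighted_mean_ord -?weighted_mean_ord. Qed.

Lemma shock_norm_ge G i : `|vshock (mark G i)| <= shock_norm G.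
Proof. exact: le_bigmax. Qed.

Lemma shock_norm_ge0 G : 0 <= shock_norm G.
Proof. by rewrite /shock_norm; elim/big_ind: _ => // x y x0 y0; rewrite le_max x0. Qed.

Lemma bounded_fun_ord (y : 'I_n -> R) : bounded_fun y.
Proof.
exists (\sum_i `|y i|); split=> [|K BK i _]; first exact: num_real.
apply: le_trans (ltW BK); rewrite (bigD1 i)//= lerDl.
exact: sumr_ge0.
Qed.

Lemma exists_unique_network_equilibrium G : L%:num < 1 ->
  exists! y : 'I_n -> R, is_network_equilibrium G y.
Proof.
move=> L1.
have [y [[by_ ey] uy]] :=
  exists_unique_bounded_equilibrium L1 (shock_norm_ge0 G) (shock_norm_ge G).
exists y; split=> [|z /network_equilibriumE ez]; first exact/network_equilibriumE.
by apply: uy; split=> //; exact: bounded_fun_ord.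
Qed.

(** Defined as a limit of iterates, which makes it measurable in the network. *)
Definition equilibrium_value (i : 'I_n) (G : measurable_network L T n) : R :=
  limn (mark_iter (@respond R L T) G ^~ i).

Lemma equilibrium_value_cvg G i : L%:num < 1 ->
  mark_iter (@respond R L T) G ^~ i @ \oo --> equilibrium_value i G.
Proof. by move=> L1; exact: (mark_iter_cvg L1 (shock_norm_ge0 G) (shock_norm_ge G)). Qed.

Lemma equilibrium_valueP G : L%:num < 1 ->
  is_network_equilibrium G (equilibrium_value ^~ G).
Proof.
move=> L1; have [y [ey _]] := exists_unique_network_equilibrium G L1.
rewrite (_ : equilibrium_value ^~ G = y)//; apply/funext => i.
apply: cvg_lim => //; apply: (mark_iter_cvg_equilibrium L1 (shock_norm_ge0 G)
  (shock_norm_ge G)); first exact/network_equilibriumE.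
exact: bounded_fun_ord.
Qed.

Lemma measurable_equilibrium_value i : L%:num < 1 ->
  measurable_fun setT (equilibrium_value i).
Proof.
move=> L1; apply: (@measurable_fun_cvg _ _ _ _
  (fun k (G : measurable_network L T n) => mark_iter (@respond R L T) G k i)).
  by move=> k; apply: measurable_mark_iter; exact: respond_measurable.
by move=> G _; exact: equilibrium_value_cvg.
Qed.

Lemma norm_equilibrium_value_le G M i : L%:num < 1 -> shock_norm G <= M ->
  `|equilibrium_value i G| <= equilibrium_bound L M.
Proof.
move=> L1 GM; have M0 := le_trans (shock_norm_ge0 G) GM.
have sM j := le_trans (shock_norm_ge G j) GM.
apply: (norm_equilibrium_le L1 M0 sM (y := equilibrium_value ^~ G)).
  by apply/network_equilibriumE; exact: equilibrium_valueP.
exact: bounded_fun_ord.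
Qed.

Lemma equilibrium_value_rate G M i k : L%:num < 1 -> shock_norm G <= M ->
  `|equilibrium_value i G - mark_iter (@respond R L T) G k i| <=
  L%:num ^+ k * equilibrium_bound L M.
Proof.
move=> L1 GM; have M0 := le_trans (shock_norm_ge0 G) GM.
have sM j := le_trans (shock_norm_ge G j) GM.
apply: (mark_iter_equilibrium_le L1 M0 sM (y := equilibrium_value ^~ G)).
  by apply/network_equilibriumE; exact: equilibrium_valueP.
exact: bounded_fun_ord.
Qed.

End network_equilibrium.

(** * Detection of large shocks *)

Section shock_excess.
Variables (R : realType) (L : {nonneg R}) (T : polishType R) (M : R).
Local Notation excess := (@add_excess R L T M).

Lemma add_excess_ge0 m z : 0 <= z -> 0 <= excess m z.
Proof. by move=> z0; rewrite addr_ge0// le_max lexx. Qed.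

Section one_graph.
Variables (V : choiceType) (G : mgraph L T V).

Lemma mark_iter_excess_ge0 k v : 0 <= mark_iter excess G k v.
Proof.
elim: k v => [//|k IH] v /=; apply: add_excess_ge0.
by apply: fsumr_ge0 => u _; rewrite mulr_ge0 ?weight_ge0.
Qed.

Lemma mark_iter_excess_eq0 k v : (forall u, `|vshock (mark G u)| <= M) ->
  mark_iter excess G k v = 0.
Proof.
move=> sM; elim: k v => [//|k IH] v /=.
rewrite /add_excess /weighted_mean (eq_fsbigr (fun=> 0)); last first.
  by move=> u _; rewrite IH mulr0.
by rewrite fsbig1// add0r max_l// subr_le0.
Qed.

(** Along the walk, a vanishing nonnegative sum with positive weights forces every
    out-neighbour to vanish at the previous depth. *)
Lemma mark_iter_excess_walk k v u : mark_iter excess G k.+1 v = 0 ->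
  walk (edge G) k v u -> `|vshock (mark G u)| <= M.
Proof.
elim: k v => [|k IH] v /=.
  rewrite /add_excess /weighted_mean (eq_fsbigr (fun=> 0)); last first.
    by move=> w _; rewrite mulr0.
  rewrite fsbig1// add0r => + <- => e0.
  by rewrite -subr_le0 -e0 le_max lexx orbT.
move=> + [w vw wu]; rewrite {1}/add_excess => e0; apply: (IH w) => //.
have wm0 : weighted_mean G (mark_iter excess G k.+1) v = 0.
  apply/eqP; rewrite eq_le; apply/andP; split.
    by rewrite -e0 lerDl le_max lexx.
  by apply: fsumr_ge0 => u' _; rewrite mulr_ge0 ?weight_ge0 ?mark_iter_excess_ge0.
apply/eqP; rewrite eq_le mark_iter_excess_ge0 andbT leNgt; apply/negP => pos.
have : 0 < weighted_mean G (mark_iter excess G k.+1) v.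
  rewrite /weighted_mean (fsbigD1 w)//=; last exact: out_finite.
  apply: ltr_pwDl; first by rewrite mulr_gt0 ?weight_gt0.
  by apply: fsumr_ge0 => u' _; rewrite mulr_ge0 ?weight_ge0 ?(mark_iter_excess_ge0 k.+1).
by rewrite wm0 ltxx.
Qed.

End one_graph.

Lemma forward_component_shock_le (g : rooted_graph L T) :
  (forall k, root_iter excess k g = 0) ->
  forall v, `|vshock (mark (classic_graph (forward_component g)) v)| <= M.
Proof.
move=> e0 [v [r [k kr wk]]].
exact: (@mark_iter_excess_walk {classic vertex g} (classic_graph g) k (groot g) v (e0 k.+1)).
Qed.

End shock_excess.

(** * Integrals against empirical laws *)

Section empirical_average.
Variables (R : realType) (L : {nonneg R}) (T : polishType R).

Lemma ge0_integral_empirical_law n (G : network L T n.+1)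
    (h : borel (local_space L T) -> \bar R) :
  measurable_fun setT h -> (forall xi, 0 <= h xi)%E ->
  (\int[empirical_law G]_xi h xi =
   n.+1%:R^-1%:E * \sum_(i < n.+1) h (rooted_at G i))%E.
Proof.
move=> mh h0; rewrite /empirical_law ge0_integral_mscale//=.
rewrite ge0_integral_measure_sum//; congr (_ * _)%E.
apply: eq_bigr => i _; rewrite integral_dirac//=.
by rewrite diracT mul1e inord_val.
Qed.

Lemma Rintegral_empirical_law n (G : network L T n.+1) (h : borel (local_space L T) -> R) :
  measurable_fun setT h ->
  \int[empirical_law G]_xi h xi =
  n.+1%:R^-1 * \sum_(i < n.+1) h (rooted_at G i).
Proof.
move=> /measurable_EFinP mh; rewrite /Rintegral integralE.
rewrite !ge0_integral_empirical_law//; [|exact: measurable_funeneg|exact: measurable_funepos].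
under eq_bigr do rewrite funeposE -[0%E]/(0%:E) -EFin_max.
under [X in (_ - _ * X)%E]eq_bigr do rewrite funenegE -[0%E]/(0%:E) -EFinN -EFin_max.
rewrite !sumEFin -!EFinM -EFinB /= -mulrBr -sumrB; congr (_ * _).
apply: eq_bigr => i _; rewrite /Num.max.
by case: ifP => h1; case: ifP => h2; move: h1 h2; lra.
Qed.


End empirical_average.
(** * Bounded random variables *)

Section bounded_random_variables.
Variables (R : realType).

(** Uniform continuity on [-B, B], except that y may lie slightly outside. *)
Lemma compact_uniform_continuity (phi : R -> R) (B e : R) : continuous phi -> 0 < e ->
  exists2 eta, 0 < eta &
    forall x y, `|x| <= B -> `|x - y| <= eta -> `|phi x - phi y| <= e.
Proof.
move=> cphi e0.
have cover : \forall eta \near 0^'+, `[- B, B]%classic `<=`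
    [set x | forall y, `|x - y| <= eta -> `|phi x - phi y| <= e].
  apply: ((@compact_near_coveringP _ _).1 (@segment_compact R (- B) B) R (0 : R)^'+
    (fun eta x => forall y, `|x - y| <= eta -> `|phi x - phi y| <= e)) => x _.
  have /cvgrPdist_lt/(_ (e / 2)) : phi z @[z --> x] --> phi x by exact: cphi.
  rewrite divr_gt0// => /(_ isT) /nbhs_ballP[r /= r0 xr].
  have r2 : 0 < r / 2 by rewrite divr_gt0.
  exists (ball x (r / 2), [set eta | eta < r / 2]).
    by split; [exact: nbhsx_ballx|exact: nbhs_right_lt].
  move=> [z eta] [/= xz etar] y zy.
  have xy : ball x r y.
    rewrite (splitr r) /ball /= (le_lt_trans (ler_distD z _ _))// ltrD//.
    exact: le_lt_trans zy etar.
  have xz' : ball x r z by apply: le_ball xz; rewrite ler_pdivrMr// mulr_natr mulr2n lerDl ltW.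
  rewrite (splitr e) (le_trans (ler_distD (phi x) _ _))// lerD//.
    by rewrite distrC ltW//; exact: xr.
  by rewrite ltW//; exact: xr.
have [eta [/= eta0 etaP]] := filter_ex (filterI (nbhs_right_gt (0 : R)) cover).
exists eta => // x y xB; apply: etaP => /=.
by rewrite in_itv/= -ler_norml.
Qed.


Lemma measurable_deviation_set dd (X : measurableType dd) (f : X -> R) c e :
  measurable_fun setT f -> measurable [set x | e <= `|f x - c|].
Proof.
move=> mf; rewrite (_ : [set _ | _] = ~` [set x | - e < - `|f x - c|]).
  apply: measurableC; apply: measurable_gt; apply: measurableT_comp => //.
  by apply: measurableT_comp => //; exact: measurable_funB.
by apply/seteqP; split=> x /=; rewrite ltrN2 leNgt => /negP.
Qed.

Variables (d : measure_display) (X : measurableType d) (Q : probability X R).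

Lemma bounded_integrable (f : X -> R) (K : R) : measurable_fun setT f ->
  (forall x, `|f x| <= K) -> Q.-integrable setT (EFin \o f).
Proof.
move=> mf fK; apply: measurable_bounded_integrable => //.
  by apply: le_lt_trans (probability_le1 Q measurableT) (ltry _).
exists K; split=> [|k Kk x _]; first exact: num_real.
exact: le_trans (fK x) (ltW Kk).
Qed.

Lemma Rintegral_dist_le (f g : X -> R) (K e : R) : 0 <= e -> measurable_fun setT f ->
  measurable_fun setT g -> (forall x, `|f x| <= K) -> (forall x, `|g x| <= K) ->
  {ae Q, forall x, `|f x - g x| <= e} ->
  `|\int[Q]_x f x - \int[Q]_x g x| <= e.
Proof.
move=> e0 mf mg fK gK fge.
have intf := bounded_integrable mf fK; have intg := bounded_integrable mg gK.
rewrite -RintegralB//; apply: le_trans (le_normr_Rintegral _ _) _ => //.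
  by have := integrableB measurableT intf intg.
have mfg : measurable_fun setT (fun x => `|f x - g x|).
  by apply: measurableT_comp => //; exact: measurable_funB.
rewrite /Rintegral -[leRHS]/(fine e%:E).
have le : (\int[Q]_x (`|f x - g x|)%:E <= e%:E)%E.
  rewrite -[leRHS]mule1 -(probability_setT Q) -integral_cst//.
  apply: ae_ge0_le_integral => //; first exact/measurable_EFinP.
  by apply: filterS fge => x fx _; rewrite lee_fin.
apply: fine_le => //; rewrite ge0_fin_numE ?integral_ge0//.
exact: le_lt_trans le (ltry _).
Qed.

Lemma Rintegral_indic (A : set X) : measurable A -> \int[Q]_x \1_A x = fine (Q A).
Proof. by move=> mA; rewrite /Rintegral integral_indic// setIT. Qed.

(** Split according to whether f is within e of c. *)
Lemma Rintegral_dist_const_le (f : X -> R) (K c e : R) : 0 <= e -> measurable_fun setT f ->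
  (forall x, `|f x| <= K) ->
  `|\int[Q]_x f x - c| <= e + (K + `|c|) * fine (Q [set x | e <= `|f x - c|]).
Proof.
move=> e0 mf fK.
have mA := measurable_deviation_set c e mf.
set A := [set _ | _] in mA *.
have K0 : 0 <= K by apply: le_trans (fK point).
have intf := bounded_integrable mf fK.
have intc : Q.-integrable setT (EFin \o cst c).
  by apply: (bounded_integrable (K := `|c|)).
have cE : c = \int[Q]_x (cst c x).
  by rewrite Rintegral_cst// [X in fine X](_ : _ = 1%E) ?mulr1//; exact: probability_setT.
rewrite {1}cE -RintegralB//; apply: le_trans (le_normr_Rintegral _ _) _ => //.
  by have := integrableB measurableT intf intc.
have mfc : measurable_fun setT (fun x => `|f x - c|).
  by apply: measurableT_comp => //; exact: measurable_funB.
have mi : measurable_fun setT (fun x => (K + `|c|) * \1_A x).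
  by apply: measurable_funM.
have i1 : Q.-integrable setT (EFin \o (fun x => (K + `|c|) * \1_A x)).
  apply: (bounded_integrable (K := K + `|c|)) => // x.
  rewrite indicE normrM ger0_norm ?addr_ge0// normr_nat.
  by case: (x \in A); rewrite ?mulr1 ?mulr0 ?addr_ge0.
have i2 : Q.-integrable setT (EFin \o cst e) by apply: (bounded_integrable (K := `|e|)).
have eE : e = \int[Q]_x (cst e x).
  by rewrite Rintegral_cst// [X in fine X](_ : _ = 1%E) ?mulr1//; exact: probability_setT.
have i3 : Q.-integrable setT (EFin \o \1_A).
  by apply: (bounded_integrable (K := 1)) => // x; rewrite indicE; case: (x \in A);
    rewrite ?normr1 ?normr0.
rewrite -Rintegral_indic// -RintegralZl// eE -RintegralD//.
apply: le_Rintegral => //.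
- apply: (bounded_integrable (K := K + `|c|)) => // x.
  by rewrite normr_id (le_trans (ler_normB _ _))// lerD.
- exact: (integrableD measurableT i2 i1).
- move=> x _ /=; rewrite indicE; case: (boolP (x \in A)) => xA.
    rewrite mulr1 (le_trans (ler_normB _ _))//.
    by rewrite (le_trans (lerD (fK x) (lexx _)))// lerDr.
  rewrite mulr0 addr0 ltW// ltNge; apply: contra xA => xA.
  by rewrite inE.
Qed.

End bounded_random_variables.
Section convergence_tools.
Variable R : realType.

Lemma ge0_ecvg0P (u : nat -> \bar R) : (forall n, 0 <= u n)%E ->
  u @ \oo --> 0%E <->
  forall delta : R, 0 < delta -> \forall n \near \oo, (u n <= delta%:E)%E.
Proof.
move=> u0; split=> [/fine_cvgP[fin cv] delta d0|small].
  have /cvgrPdist_le/(_ _ d0) := cv.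
  apply: filterS2 fin => n fn; rewrite /= sub0r normrN ger0_norm ?fine_ge0// => ud.
  by rewrite -(fineK fn) lee_fin.
apply/fine_cvgP; split.
  apply: filterS (small 1 ltr01) => n u1.
  by rewrite ge0_fin_numE// (le_lt_trans u1) ?ltry.
apply/cvgrPdist_le => e e0; apply: filterS (small e e0) => n ue.
rewrite /= sub0r normrN ger0_norm ?fine_ge0// -lee_fin fineK//.
by rewrite ge0_fin_numE// (le_lt_trans ue) ?ltry.
Qed.

Lemma measurable_borel_continuous (X : ptopologicalType) (h : X -> R) :
  continuous h -> measurable_fun setT (h : borel X -> R).
Proof.
move=> ch; apply: measurable_fun_gt => a.
apply: sub_sigma_algebra; apply: (@open_comp _ _ h [set y | a < y]).
  by move=> ? _; exact: ch.
exact: open_gt.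
Qed.

Variables (d : nat -> measure_display) (Omega : forall n, measurableType (d n)).
Variable Pr : forall n, probability (Omega n) R.

Lemma cvg_in_probability_Rintegral (A : forall n, Omega n -> R) (K c : R) :
  (forall n, measurable_fun setT (A n)) -> (forall n w, `|A n w| <= K) ->
  cvg_in_probability Pr A c -> \int[Pr n]_w A n w @[n --> \oo] --> c.
Proof.
move=> mA AK cvA; apply/cvgrPdist_le => e e0.
have K0 : 0 <= K by apply: le_trans (AK 0%N point).
have e20 : 0 < e / 2 by rewrite divr_gt0.
have p0 : 0 < e / 2 / (K + `|c| + 1) by rewrite divr_gt0// ltr_wpDl// addr_ge0.
have /ge0_ecvg0P/(_ _ p0) := cvA _ e20.
move=> /(_ (fun=> measure_ge0 _ _)); apply: filterS => n small.
rewrite distrC (le_trans (Rintegral_dist_const_le _ c (ltW e20) (mA n) (AK n)))//.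
rewrite [leRHS]splitr lerD2l.
have fs : fine (Pr n [set w | e / 2 <= `|A n w - c|]) <= e / 2 / (K + `|c| + 1).
  rewrite -lee_fin fineK// fin_num_measure//; exact: measurable_deviation_set.
apply: (@le_trans _ _ ((K + `|c| + 1) * (e / 2 / (K + `|c| + 1)))).
  by apply: ler_pM => //; rewrite ?addr_ge0 ?fine_ge0// lerDl.
by rewrite mulrC divfK// gt_eqF// ltr_wpDl// addr_ge0.
Qed.

End convergence_tools.

(** * Shocks of the finite and limiting networks *)

Section shocks.
Variables (R : realType) (L : {nonneg R}) (T : polishType R).
Variables (d : nat -> measure_display) (Omega : forall n, measurableType (d n)).
Variable Pr : forall n, probability (Omega n) R.
Variable G : forall n, {RV (Pr n) >-> measurable_network L T n.+1}.
Variable P : probability (borel (local_space L T)) R.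
Hypothesis shock_moment :
  (ereal_sup (range (fun n => 'E_(Pr n)[fun w => shock_norm (G n w)])) < +oo)%E.
Hypothesis local_cvg : forall h : local_space L T -> R, continuous h -> bounded_fun h ->
  cvg_in_probability Pr
    (fun n w => \int[empirical_law (G n w)]_xi h xi) (\int[P]_xi h xi).

Lemma measurable_network_comp n dd (Y : measurableType dd)
    (f : measurable_network L T n.+1 -> Y) :
  measurable_fun setT f -> measurable_fun setT (fun w => f (G n w)).
Proof. by move=> mf; apply: (measurableT_comp mf); exact: measurable_funPT. Qed.

(** Markov's inequality, with C the supremum of the expected norms. *)
Lemma shock_tail : exists2 C : R, 0 <= C &
  forall n (M : R), 0 < M ->
    (Pr n [set w | (M < shock_norm (G n w))%R] <= (C / M)%:E)%E.
Proof.
have := shock_moment; set S := ereal_sup _ => Soo.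
have ES n : ('E_(Pr n)[fun w => shock_norm (G n w)] <= S)%E.
  by apply: ereal_sup_ubound; exists n.
have E0 n : (0 <= 'E_(Pr n)[fun w => shock_norm (G n w)])%E.
  by apply: expectation_ge0 => w; exact: shock_norm_ge0.
have S0 : (0 <= S)%E := le_trans (E0 0%N) (ES 0%N).
have Sfin : S \is a fin_num by rewrite ge0_fin_numE.
exists (fine S); first exact: fine_ge0.
move=> n M M0; rewrite mulrC EFinM lee_pdivlMl// fineK//.
have ms : measurable_fun setT (fun w => shock_norm (G n w)).
  by apply: measurable_network_comp; exact: measurable_shock_norm.
apply: le_trans (ES n); rewrite unlock.
have := @le_integral_abse _ _ _ (Pr n) setT measurableT
  (EFin \o (fun w => shock_norm (G n w))) M _ M0.
have /measurable_EFinP ems := ms; move=> /(_ ems); rewrite setTI => le.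
apply: (le_trans _ (le_trans le _)).
  rewrite lee_pmul2l//; apply: le_measure; rewrite ?inE.
  - exact: measurable_gt.
  - rewrite (_ : [set _ | _] = [set w | M <= `|shock_norm (G n w) - 0|])//.
      exact: measurable_deviation_set.
    by apply/seteqP; split=> w /=; rewrite subr0 lee_fin.
  - by move=> w /= Mw; rewrite lee_fin (le_trans (ltW Mw))// ler_norm.
by under eq_integral do rewrite gee0_abs ?lee_fin ?shock_norm_ge0//.
Qed.

Section network_average.
Variables (Phi : vertex_mark L T -> R -> R) (k : nat) (f : R -> R).
Hypotheses (cPhi : jointly_continuous Phi) (mPhi : forall n, preserves_measurability n Phi).
Hypothesis cf : continuous f.

Lemma local_test_continuous : continuous (fun xi => f (local_iter Phi k xi)).
Proof.
move=> xi; apply: (@continuous_comp _ _ _ (local_iter Phi k) f).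
  exact: local_iter_continuous.
exact: cf.
Qed.

Lemma empirical_integral n (H : network L T n.+1) :
  \int[empirical_law H]_xi f (local_iter Phi k xi) =
  n.+1%:R^-1 * \sum_(i < n.+1) f (mark_iter Phi H k i).
Proof.
rewrite Rintegral_empirical_law; last first.
  exact: (measurable_borel_continuous local_test_continuous).
congr (_ * _); apply: eq_bigr => i _.
by rewrite /rooted_at local_iter_class// root_iter_rooted_network.
Qed.

Lemma measurable_empirical_integral n : measurable_fun setT
  (fun w => \int[empirical_law (G n w)]_xi f (local_iter Phi k xi)).
Proof.
under eq_fun do rewrite empirical_integral.
apply: measurable_funM => //; apply: measurable_sum => i.
apply: (measurableT_comp (continuous_measurable_fun cf)).
apply: (@measurable_network_comp _ _ _ (fun H => mark_iter Phi H k i)).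
exact: measurable_mark_iter.
Qed.

End network_average.

(** The average of min(1, excess) over the vertices vanishes whenever the shock
    norm is at most M, which has probability at least 1 - C / M > 0 for every n.
    Since these averages converge in probability to the integral of min(1, excess)
    against P, this integral is zero. *)
Lemma limit_shocks_bounded : exists2 M : R, 0 <= M &
  {ae P, forall xi, forall k, local_iter (@add_excess R L T M) k xi = 0}.
Proof.
have [C C0 tail] := shock_tail.
(* Any M > C works: then C / M < 1. *)
pose M := C + 1; have M0 : 0 < M by rewrite ltr_wpDl.
exists M; first exact: ltW.
apply: ae_foralln => k.
pose f (x : R) := Num.min 1 x.
have cf : continuous f.
  move=> x; apply: continuous_min; [exact: cvg_cst|exact: cvg_id].
have cE := @add_excess_continuous R L T M.
have mE n := @add_excess_measurable R L T n M.
have ch := @local_test_continuous _ k f cE cf.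
have mh := measurable_borel_continuous ch.
have h01 xi : 0 <= f (local_iter (@add_excess R L T M) k xi) <= 1.
  by apply: min1_01; exact: mark_iter_excess_ge0.
have hbd : bounded_fun (fun xi => f (local_iter (@add_excess R L T M) k xi)).
  exists 1; split=> // K K1 xi _; case/andP: (h01 xi) => h0 h1.
  by rewrite /= ger0_norm// (le_trans h1)// ltW.
have inth : P.-integrable setT (EFin \o (fun xi => f (local_iter (@add_excess R L T M) k xi))).
  apply: (bounded_integrable (K := 1) _ mh) => xi; case/andP: (h01 xi) => h0 h1.
  by rewrite ger0_norm.
have := local_cvg ch hbd; set c := \int[P]_xi _ => cv.
have c0 : c = 0.
  apply/eqP; rewrite eq_le Rintegral_ge0 ?andbT; last first.
    by move=> xi _; case/andP: (h01 xi).
  rewrite leNgt; apply/negP => cpos.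
  (* With M = C + 1, delta + C / M = (1/2 + C) / (C + 1) < 1. *)
  pose delta := (2 * M)^-1; have d0 : 0 < delta by rewrite invr_gt0 mulr_gt0.
  have /ge0_ecvg0P/(_ _ d0) := cv _ cpos.
  move=> /(_ (fun=> measure_ge0 _ _))[N _ /(_ N (leqnn N))] /=.
  set A := [set w | _]; move=> PA.
  have mA : measurable A.
    exact: (measurable_deviation_set _ _ (@measurable_empirical_integral _ k f cE mE cf N)).
  pose B := [set w | M < shock_norm (G N w)].
  have mB : measurable B.
    by apply: measurable_gt; apply: measurable_network_comp; exact: measurable_shock_norm.
  have cover : setT `<=` A `|` B.
    move=> w _; have [lt|le] := ltP M (shock_norm (G N w)); [by right|left].
    rewrite /A /= empirical_integral//.
    rewrite big1 => [|i _]; first by rewrite mulr0 sub0r normrN ger0_norm// ltW.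
    rewrite mark_iter_excess_eq0 /f; first by rewrite min_r.
    by move=> u; rewrite (le_trans (shock_norm_ge _ _)).
  have : (1 <= (delta + C / M)%:E)%E.
    rewrite -(probability_setT (Pr N)) EFinD.
    apply: (@le_trans _ _ (Pr N (A `|` B))).
      by apply: le_measure; rewrite ?inE//; exact: measurableU.
    apply: le_trans (measureU2 _ mA mB) _.
    by apply: leeD => //; exact: tail.
  rewrite lee_fin leNgt => /negP; apply.
  rewrite /delta /M invfM -mulrDl ltr_pdivrMr// mul1r addrC ltrD2l.
  by rewrite invf_lt1// ltr1n.
have : (\int[P]_xi `|(EFin \o (fun xi => f (local_iter (@add_excess R L T M) k xi))) xi| = 0)%E.
  rewrite -[RHS]/((0:R)%:E) -c0 /c /Rintegral fineK ?integrable_fin_num//.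
  apply: eq_integral => xi _ /=; rewrite ger0_norm//.
  by case/andP: (h01 xi).
move=> /(ae_eq_integral_abs _ measurableT _).1 => /(_ (measurable_int _ inth)).
apply: filterS => xi /(_ I) /= [].
exact: min1_eq0.
Qed.

End shocks.
(** * The equilibrium of the limiting network *)

Section limit_equilibrium.
Variables (R : realType) (L : {nonneg R}) (T : polishType R).
Hypothesis L1 : L%:num < 1.
Local Notation iterate := (local_iter (@respond R L T)).
Local Notation fc := (@forward_component R L T).

(** The upper limit makes this measurable without knowing where the iterates
    converge; under the limiting law they do so almost surely. *)
Definition limit_value (xi : borel (local_space L T)) : R :=
  fine (limn_esup (fun k => (iterate k xi)%:E)).

Lemma measurable_local_iter k : measurable_fun setT (iterate k : borel _ -> R).
Proof.
apply: measurable_borel_continuous; apply: local_iter_continuous.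
exact: respond_continuous.
Qed.

Lemma measurable_limit_value : measurable_fun setT limit_value.
Proof.
apply: measurableT_comp => //; apply: measurable_fun_limn_esup => k.
by apply/measurable_EFinP; exact: measurable_local_iter.
Qed.

Section one_class.
Variables (M : R) (xi : local_space L T).
Hypothesis M0 : 0 <= M.
Hypothesis noexcess : forall k, local_iter (@add_excess R L T M) k xi = 0.

Lemma class_shock_le (g : rooted_graph L T) : rooted_class g = xi ->
  forall v, `|vshock (mark (classic_graph (fc g)) v)| <= M.
Proof.
move=> gxi; apply: forward_component_shock_le => k.
by rewrite -local_iter_class ?gxi//; exact: add_excess_continuous.
Qed.

Lemma class_equilibrium (g : rooted_graph L T) : rooted_class g = xi ->
  exists! y : {classic vertex (fc g)} -> R, is_bounded_equilibrium y.
Proof.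
by move=> gxi; exact: (exists_unique_bounded_equilibrium L1 M0 (class_shock_le gxi)).
Qed.

(** The iterates at xi are computed on a chosen representative; continuity makes
    them the same on g, and they only read the forward component of g. *)
Lemma class_iterE (g : rooted_graph L T) k : rooted_class g = xi ->
  iterate k xi = mark_iter (@respond R L T) (classic_graph (fc g)) k (groot (fc g)).
Proof.
move=> <-; rewrite local_iter_class; last exact: respond_continuous.
by rewrite -root_iter_forward_component.
Qed.

Lemma class_limit_value (g : rooted_graph L T) (y : {classic vertex (fc g)} -> R) :
  rooted_class g = xi -> is_bounded_equilibrium y -> limit_value xi = y (groot (fc g)).
Proof.
move=> gxi [bdy ey].
have cv : (fun k => (iterate k xi)%:E) @ \oo --> (y (groot (fc g)))%:E.
  apply/fine_cvgP; split; first by apply: nearW.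
  rewrite (_ : fine \o _ = fun k => mark_iter (@respond R L T) (classic_graph (fc g)) k (groot (fc g))).
    exact: (mark_iter_cvg_equilibrium L1 M0 (class_shock_le gxi) ey bdy).
  by apply/funext => k /=; rewrite (class_iterE k gxi).
rewrite /limit_value is_cvg_limn_esupE; last by apply/cvg_ex; eexists; exact: cv.
by rewrite (cvg_lim _ cv).
Qed.

Let g := repr xi.
Let gxi : rooted_class g = xi. Proof. by rewrite /rooted_class reprK. Qed.

Lemma norm_limit_value_le : `|limit_value xi| <= equilibrium_bound L M.
Proof.
have [y [[bdy ey] _]] := class_equilibrium gxi.
rewrite (class_limit_value gxi (conj bdy ey)).
exact: (norm_equilibrium_le L1 M0 (class_shock_le gxi)).
Qed.

Lemma limit_value_rate k :
  `|limit_value xi - iterate k xi| <= L%:num ^+ k * equilibrium_bound L M.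
Proof.
have [y [[bdy ey] _]] := class_equilibrium gxi.
rewrite (class_limit_value gxi (conj bdy ey)) (class_iterE k gxi).
exact: (mark_iter_equilibrium_le L1 M0 (class_shock_le gxi)).
Qed.

End one_class.
End limit_equilibrium.

(** * Convergence of averages *)

Section average_convergence.
Variables (R : realType) (L : {nonneg R}) (T : polishType R).
Variables (d : nat -> measure_display) (Omega : forall n, measurableType (d n)).
Variable Pr : forall n, probability (Omega n) R.
Variable G : forall n, {RV (Pr n) >-> measurable_network L T n.+1}.
Variable P : probability (borel (local_space L T)) R.
Hypothesis L1 : L%:num < 1.
Hypothesis shock_moment :
  (ereal_sup (range (fun n => 'E_(Pr n)[fun w => shock_norm (G n w)])) < +oo)%E.
Hypothesis local_cvg : forall h : local_space L T -> R, continuous h -> bounded_fun h ->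
  cvg_in_probability Pr
    (fun n w => \int[empirical_law (G n w)]_xi h xi) (\int[P]_xi h xi).

Lemma equilibrium_bound_le M M' : M <= M' -> equilibrium_bound L M <= equilibrium_bound L M'.
Proof.
by move=> MM; rewrite ler_pM2r ?invr_gt0 ?subr_gt0// ler_wpM2l.
Qed.

Definition equilibrium_average (phi : R -> R) n (w : Omega n) : R :=
  n.+1%:R^-1 * \sum_(i < n.+1) phi (equilibrium_value i (G n w)).

Lemma measurable_equilibrium_average phi n : continuous phi ->
  measurable_fun setT (@equilibrium_average phi n).
Proof.
move=> cphi; apply: measurable_funM => //; apply: measurable_sum => i.
apply: (measurableT_comp (continuous_measurable_fun cphi)).
apply: (@measurable_network_comp _ _ _ _ _ _ G _ _ _ (equilibrium_value i)).
exact: measurable_equilibrium_value.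
Qed.

Lemma norm_average_le n (a : 'I_n.+1 -> R) K : (forall i, `|a i| <= K) ->
  `|n.+1%:R^-1 * \sum_i a i| <= K.
Proof.
move=> aK; rewrite normrM ger0_norm// ler_pdivrMl//.
apply: le_trans (ler_norm_sum _ _ _) _.
apply: (@le_trans _ _ (\sum_(i < n.+1) K)); first by apply: ler_sum => i _.
by rewrite sumr_const card_ord -[leLHS]mulr_natl.
Qed.

(** Outside an event of probability at most delta / 2 the shocks are at most M1. There
    the k-th iterates are eta-close to the equilibrium, so replacing the equilibrium
    by iterates costs e / 3, once on the finite network and once in the limit. The
    averages of the iterates converge by hypothesis. *)
Lemma equilibrium_average_cvg phi : continuous phi -> bounded_fun phi ->
  cvg_in_probability Pr (@equilibrium_average phi) (\int[P]_xi phi (limit_value xi)).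
Proof.
move=> cphi bphi e e0.
have [K phiK] : exists K, forall x, `|phi x| <= K.
  by case: bphi => K [_ /(_ (K + 1))]; rewrite ltrDl ltr01 => /(_ isT) h;
    exists (K + 1) => x; exact: h.
have [C C0 tail] := shock_tail shock_moment.
have [M M0 nul] := limit_shocks_bounded shock_moment local_cvg.
apply/ge0_ecvg0P => [n|delta d0]; first exact: measure_ge0.
have e30 : 0 < e / 3 by rewrite divr_gt0.
(* The first term dominates the bound on the limiting shocks, the second makes
   C / M1 at most delta / 2. *)
pose M1 := Num.max (M + 1) (2 * C / delta).
have M10 : 0 < M1 by rewrite lt_max ltr_wpDl.
have MM1 : M <= M1 by rewrite /M1 le_max lerDl ler01.
have tailM n : (Pr n [set w | (M1 < shock_norm (G n w))%R] <= (delta / 2)%:E)%E.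
  apply: le_trans (tail n M1 M10) _; rewrite lee_fin ler_pdivrMr//.
  apply: (@le_trans _ _ (delta / 2 * (2 * C / delta))).
    by rewrite [leRHS](_ : _ = C)//; field; rewrite gt_eqF.
  apply: ler_wpM2l; first by rewrite divr_ge0// ltW.
  by rewrite /M1 le_max lexx orbT.
pose B := equilibrium_bound L M1.
have [eta eta0 unif] := compact_uniform_continuity B cphi e30.
have [k rate] : exists k, L%:num ^+ k * B <= eta.
  have /cvgrPdist_le/(_ _ eta0)[k _ /(_ k (leqnn k))] := cvg_rate0 M1 L1.
  by rewrite sub0r normrN => h; exists k; exact: le_trans (ler_norm _) h.
pose h xi := phi (local_iter (@respond R L T) k xi).
have ch : continuous h by apply: local_test_continuous => //; exact: respond_continuous.
have bh : bounded_fun h.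
  by exists K; split=> [|K' KK' xi _]; [exact: num_real|rewrite /= (le_trans (phiK _))// ltW].
have limh : `|\int[P]_xi phi (limit_value xi) - \int[P]_xi h xi| <= e / 3.
  apply: (Rintegral_dist_le (K := K)) => //.
  - exact: ltW.
  - apply: (measurableT_comp (continuous_measurable_fun cphi)).
    exact: measurable_limit_value.
  - exact: measurable_borel_continuous.
  - by move=> xi; exact: phiK.
  - apply: (@filterS _ (almost_everywhere P)) nul => xi ex0; apply: unif.
      by apply: le_trans (norm_limit_value_le L1 M0 ex0) _; exact: equilibrium_bound_le.
    apply: le_trans rate; apply: le_trans (limit_value_rate L1 M0 ex0 k) _.
    by rewrite ler_wpM2l ?exprn_ge0//; exact: equilibrium_bound_le.
have d20 : 0 < delta / 2 by rewrite divr_gt0.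
have /ge0_ecvg0P/(_ _ d20) := local_cvg ch bh e30.
move=> /(_ (fun=> measure_ge0 _ _)); apply: filterS => n Ple.
have mh : measurable_fun setT (fun w => \int[empirical_law (G n w)]_xi h xi).
  apply: measurable_empirical_integral => //; first exact: respond_continuous.
  by move=> ?; exact: respond_measurable.
have mA := measurable_deviation_set (\int[P]_xi h xi) (e / 3) mh.
have mB : measurable [set w | M1 < shock_norm (G n w)].
  by apply: measurable_gt; apply: measurable_network_comp; exact: measurable_shock_norm.
have mC := measurable_deviation_set (\int[P]_xi phi (limit_value xi)) e
  (@measurable_equilibrium_average phi n cphi).
rewrite [delta]splitr EFinD; apply: le_trans (leeD Ple (tailM n)).
apply: le_trans (measureU2 _ mA mB).
apply: le_measure; rewrite ?inE//; first exact: measurableU.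
move=> w /= far; have [lt|le] := ltP M1 (shock_norm (G n w)); [by right|left].
rewrite /= leNgt; apply/negP => near_; move: far; rewrite leNgt => /negP; apply.
have close : `|equilibrium_average phi w - \int[empirical_law (G n w)]_xi h xi| <= e / 3.
  rewrite empirical_integral//; [|exact: respond_continuous].
  rewrite -mulrBr -sumrB; apply: norm_average_le => i; apply: unif.
    exact: norm_equilibrium_value_le.
  by apply: le_trans rate; exact: equilibrium_value_rate.
move: close near_ limh; rewrite (distrC (\int[P]_xi phi _)).
set a := equilibrium_average _ _; set b := \int[_]_xi _; set c := \int[P]_xi h xi.
set l := \int[P]_xi _ => ab bc cl.
apply: (@le_lt_trans _ _ (`|a - b| + `|b - c| + `|c - l|)).
  by rewrite -addrA (le_trans (ler_distD b _ _))// lerD2l ler_distD.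
have -> : e = e / 3 + e / 3 + e / 3 by field.
by rewrite ltr_leD// ler_ltD.
Qed.

End average_convergence.
(** * Uniformly sampled vertices *)

Section uniform_index.
Variables (R : realType) (d d' : measure_display).
Variables (X : measurableType d) (Y : measurableType d') (Q : probability X R).

Lemma ge0_integral_mrestr (D : set X) (mD : measurable D) (f : X -> \bar R) :
  measurable_fun setT f -> (forall x, 0 <= f x)%E ->
  (\int[mrestr Q mD]_x f x = \int[Q]_(x in D) f x)%E.
Proof.
move=> mf f0; rewrite -(setUv D) ge0_integral_setU//.
- rewrite (eq_measure_integral (D := ~` D) mzero) => [|A mA AD].
    rewrite integral_measure_zero adde0.
    apply: eq_measure_integral => A mA AD.
    by rewrite -[LHS]/(Q (A `&` D)) (setIidl AD).
  by rewrite -[LHS]/(Q (A `&` D)) (disjoints_subset A D).2// measure0.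
- exact: measurableC.
- by rewrite setUv.
- by apply/disj_setPCl.
Qed.

Variable H : {mfun X >-> Y}.

(** The law of H on the event D is p times its law: two measures that agree on
    measurable sets have the same integrals. *)
Lemma ge0_integral_independent (D : set X) (mD : measurable D) (p : {nonneg R})
    (f : Y -> \bar R) :
  (forall A, measurable A -> Q (H @^-1` A `&` D) = (p%:num%:E * Q (H @^-1` A))%E) ->
  measurable_fun setT f -> (forall y, 0 <= f y)%E ->
  (\int[Q]_(x in D) f (H x) = p%:num%:E * \int[Q]_x f (H x))%E.
Proof.
move=> indep mf f0.
have mfH : measurable_fun setT (f \o H) by exact: measurableT_comp.
have mH : measurable_fun setT H by exact: measurable_funPT.
rewrite -(ge0_integral_mrestr mD mfH); last by move=> x; exact: f0.
have := ge0_integral_pushforward mH (mrestr Q mD) measurableT mf (fun y _ => f0 y).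
rewrite preimage_setT => <-.
have := ge0_integral_pushforward mH Q measurableT mf (fun y _ => f0 y).
rewrite preimage_setT => <-.
rewrite -ge0_integral_mscale//.
by apply: eq_measure_integral => A mA _; exact: indep.
Qed.

Lemma Rintegral_independent (D : set X) (p : {nonneg R}) (f : Y -> R) (K : R) :
  measurable D ->
  (forall A, measurable A -> Q (H @^-1` A `&` D) = (p%:num%:E * Q (H @^-1` A))%E) ->
  measurable_fun setT f -> (forall y, `|f y| <= K) ->
  (\int[Q]_(x in D) (f (H x))%:E = p%:num%:E * \int[Q]_x (f (H x))%:E)%E.
Proof.
move=> mD indep mf fK.
have mfH : measurable_fun setT (f \o H) by exact: measurableT_comp.
have intf : Q.-integrable setT (EFin \o (f \o H)).
  by apply: (bounded_integrable (K := K) Q mfH) => x; exact: fK.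
have mE : measurable_fun setT (EFin \o f) by exact/measurable_EFinP.
have posE : (EFin \o (f \o H))^\+%E = (EFin \o f)^\+%E \o H.
  by apply/funext => x; rewrite /= !funeposE.
have negE : (EFin \o (f \o H))^\-%E = (EFin \o f)^\-%E \o H.
  by apply/funext => x; rewrite /= !funenegE.
have pfin := integrable_pos_fin_num measurableT intf.
have nfin := integrable_neg_fin_num measurableT intf.
rewrite integralE [in RHS]integralE muleBr//; last by rewrite fin_num_adde_defl// fin_numN.
congr (_ - _)%E.
  rewrite -[(fun x => (f (H x))%:E)]/(EFin \o (f \o H)) posE.
  apply: (ge0_integral_independent mD indep) => //.
  exact: measurable_funepos.
rewrite -[(fun x => (f (H x))%:E)]/(EFin \o (f \o H)) negE.
apply: (ge0_integral_independent mD indep) => //.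
exact: measurable_funeneg.
Qed.

(** Partition the space by the value of o; on each part o is constant and the
    independence of o and H factors out the probability of the part. *)
Lemma integral_uniform_index N (o : X -> 'I_N.+1) (f : 'I_N.+1 -> Y -> R) (K : R) :
  (forall i, measurable (o @^-1` [set i])) ->
  (forall i A, measurable A ->
     Q (H @^-1` A `&` o @^-1` [set i]) = (N.+1%:R^-1%:E * Q (H @^-1` A))%E) ->
  (forall i, measurable_fun setT (f i)) -> (forall i y, `|f i y| <= K) ->
  (\int[Q]_x (f (o x) (H x))%:E = \int[Q]_x (N.+1%:R^-1 * \sum_i f i (H x))%:E)%E.
Proof.
move=> mo indep mf fK.
have mfH i : measurable_fun setT (fun x => f i (H x)).
  by apply: (measurableT_comp (mf i)); exact: measurable_funPT.
have intf i : Q.-integrable setT (fun x => (f i (H x))%:E).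
  by apply: (bounded_integrable (K := K) Q (mfH i)) => x; exact: fK.
have cover : \big[setU/set0]_(i <- index_enum 'I_N.+1) (o @^-1` [set i]) = setT.
  by apply/seteqP; split=> // x _; rewrite -bigcup_seq; exists (o x) => //=; exact: mem_index_enum.
have mfo : measurable_fun setT (fun x => f (o x) (H x)).
  apply: measurable_fun_gt => a.
  rewrite (_ : [set _ | _] = \big[setU/set0]_(i <- index_enum 'I_N.+1)
     (o @^-1` [set i] `&` [set x | a < f i (H x)])).
    by apply: bigsetU_measurable => i _; apply: measurableI => //; exact: measurable_gt.
  apply/seteqP; split=> x; rewrite -bigcup_seq.
    by move=> ax; exists (o x) => //=; exact: mem_index_enum.
  by move=> [i _ [/= <-]].
transitivity (\sum_(i < N.+1) \int[Q]_(x in o @^-1` [set i]) (f (o x) (H x))%:E)%E.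
  rewrite -{1}cover integral_bigsetU_EFin//.
  - exact: index_enum_uniq.
  - by apply/trivIsetP => i j _ _ ij; apply/seteqP; split=> // x [/= oi oj]; move: ij; rewrite -oi -oj eqxx.
  - by rewrite cover; exact/measurable_EFinP.
transitivity (\sum_(i < N.+1) N.+1%:R^-1%:E * \int[Q]_x (f i (H x))%:E)%E.
  apply: eq_bigr => i _.
  rewrite (eq_integral (fun x => (f i (H x))%:E)); last by move=> x; rewrite inE => ox; rewrite (ox : o x = i).
  exact: (@Rintegral_independent _ (N.+1%:R^-1)%:nng (f i) K (mo i) (indep i) (mf i) (fK i)).
under [RHS]eq_integral do rewrite EFinM -sumEFin.
rewrite integralZl//; last exact: integrable_sum.
rewrite integral_sum// fin_num_sume_distrr// => i j _ _.
by rewrite fin_num_adde_defr// integrable_fin_num.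
Qed.

End uniform_index.
(** * Convergence in distribution *)

Lemma lipschitz_continuous (R : realType) (phi : R -> R) :
  [lipschitz phi u | u in [set: R]] -> continuous phi.
Proof.
move=> [k0 [_ /(_ (k0 + 1))]]; rewrite ltrDl ltr01 => /(_ isT).
set k := k0 + 1 => lip x; apply/cvgrPdist_le => e e0.
have kpos : 0 < `|k| + 1 by rewrite ltr_wpDl.
have : \forall y \near x, `|x - y| <= e / (`|k| + 1).
  apply/nbhs_ballP; exists (e / (`|k| + 1)) => /=; first by rewrite divr_gt0.
  by move=> y; exact: ltW.
apply: filterS => y xy; have := lip (x, y) (conj I I) => /= le.
apply: le_trans le _; apply: (@le_trans _ _ ((`|k| + 1) * `|x - y|)).
  by rewrite ler_wpM2r// (le_trans (ler_norm _))// lerDl.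
by rewrite -ler_pdivlMl// mulrC.
Qed.

Section distribution.
Variables (R : realType) (L : {nonneg R}) (T : polishType R).
Variables (d : nat -> measure_display) (Omega : forall n, measurableType (d n)).
Variable Pr : forall n, probability (Omega n) R.
Variable G : forall n, {RV (Pr n) >-> measurable_network L T n.+1}.
Variable P : probability (borel (local_space L T)) R.
Hypothesis L1 : L%:num < 1.

(** The expectation at the sampled vertex is the expectation of the average over
    all vertices, which is bounded and converges in probability to a constant. *)
Lemma equilibrium_cvg_in_distribution (o : forall n, Omega n -> 'I_n.+1) :
  (forall phi, continuous phi -> bounded_fun phi ->
     cvg_in_probability Pr (equilibrium_average G phi) (\int[P]_xi phi (limit_value xi))) ->
  (forall n i, measurable (o n @^-1` [set i])) ->
  (forall n i (A : set (measurable_network L T n.+1)), measurable A ->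
     Pr n (G n @^-1` A `&` o n @^-1` [set i]) =
     ((n.+1%:R^-1)%:E * Pr n (G n @^-1` A))%E) ->
  cvg_in_distribution Pr (fun n w => equilibrium_value (o n w) (G n w)) P
    (@limit_value R L T).
Proof.
move=> cvp mo indep h ch bh.
have [K hK] : exists K, forall x, `|h x| <= K.
  by case: bh => K [_ /(_ (K + 1))]; rewrite ltrDl ltr01 => /(_ isT) hK;
    exists (K + 1) => x; exact: hK.
have mh := continuous_measurable_fun ch.
have avK n (w : Omega n) : `|equilibrium_average G h w| <= K.
  by apply: norm_average_le => i; exact: hK.
have mav n := measurable_equilibrium_average G L1 ch (n := n).
have cv := cvg_in_probability_Rintegral mav avK (cvp h ch bh).
rewrite unlock.
have intl : P.-integrable setT (EFin \o (h \o @limit_value R L T)).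
  apply: (bounded_integrable (K := K) P) => [|xi]; last exact: hK.
  by apply: measurableT_comp => //; exact: measurable_limit_value.
rewrite -[X in _ --> X]fineK ?integrable_fin_num//.
rewrite (_ : (fun n => _) = EFin \o (fun n => \int[Pr n]_w equilibrium_average G h w)).
  by apply: cvg_EFin; [exact: nearW|exact: cv].
apply/funext => n /=; rewrite fineK; last first.
  apply: integrable_fin_num => //.
  by apply: (bounded_integrable (K := K) (Pr n) (mav n)) => w; exact: avK.
apply: (@integral_uniform_index R _ _ _ _ (Pr n) (G n) n (o n)
  (fun i H => h (equilibrium_value i H)) K (mo n) (indep n)) => [i|i H]; last exact: hK.
by apply: measurableT_comp => //; exact: measurable_equilibrium_value.
Qed.

End distribution.

(* The n-th network has vertex set [n+1] = 'I_n.+1. *)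
Theorem theorem4p1 (R : realType) (L : {nonneg R}) (T : polishType R)
    (d : nat -> measure_display) (Omega : forall n, measurableType (d n))
    (Pr : forall n, probability (Omega n) R)
    (G : forall n, {RV (Pr n) >-> measurable_network L T n.+1})
    (P : probability (borel (local_space L T)) R) :
  L%:num < 1 ->
  (ereal_sup (range (fun n => 'E_(Pr n)[fun w => shock_norm (G n w)])) < +oo)%E ->
  (forall h : local_space L T -> R, continuous h -> bounded_fun h ->
     cvg_in_probability Pr
       (fun n w => \int[empirical_law (G n w)]_xi h xi) (\int[P]_xi h xi)) ->
  (forall n w, exists! y : 'I_n.+1 -> R, is_network_equilibrium (G n w) y) /\
  {ae P, forall xi, forall g : rooted_graph L T, rooted_class g = xi ->
     exists! y : {classic vertex (forward_component g)} -> R,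
       is_bounded_equilibrium y} /\
  exists (x : forall n, 'I_n.+1 -> {RV (Pr n) >-> R}) (xo : {RV P >-> R}),
  [/\ forall n w, is_network_equilibrium (G n w) (fun i => x n i w),
      {ae P, forall xi, forall (g : rooted_graph L T)
         (y : {classic vertex (forward_component g)} -> R),
         rooted_class g = xi -> is_bounded_equilibrium y ->
         xo xi = y (groot (forward_component g))},
      forall phi : R -> R, bounded_fun phi ->
        [lipschitz phi u | u in [set: R]] ->
        cvg_in_probability Pr
          (fun n w => n.+1%:R^-1 * \sum_(i < n.+1) phi (x n i w))
          (fine 'E_P[phi \o xo])
    & forall o : forall n, Omega n -> 'I_n.+1,
        (forall n i, measurable (o n @^-1` [set i])) ->
        (forall n i (A : set (measurable_network L T n.+1)), measurable A ->
           Pr n (G n @^-1` A `&` o n @^-1` [set i]) =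
           ((n.+1%:R^-1)%:E * Pr n (G n @^-1` A))%E) ->
        cvg_in_distribution Pr (fun n w => x n (o n w) w) P xo].
Proof.
move=> L1 shock_moment local_cvg.
have [M M0 noexcess] := limit_shocks_bounded shock_moment local_cvg.
have average := equilibrium_average_cvg L1 shock_moment local_cvg.
split; first by move=> n w; exact: exists_unique_network_equilibrium.
split.
  apply: (@filterS _ (almost_everywhere P)) noexcess => xi ex0 g gxi.
  exact: (class_equilibrium L1 M0 ex0 gxi).
have mx n i : measurable_fun setT (fun w => equilibrium_value i (G n w)).
  apply: (@measurable_network_comp _ _ _ _ _ _ G _ _ _ (equilibrium_value i)).
  exact: measurable_equilibrium_value.
exists (fun n i => mfun_Sub (mem_set (mx n i))).
exists (mfun_Sub (mem_set (@measurable_limit_value R L T))).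
split.
- by move=> n w; exact: equilibrium_valueP.
- apply: (@filterS _ (almost_everywhere P)) noexcess => xi ex0 g y gxi ey.
  exact: (class_limit_value L1 M0 ex0 gxi ey).
- move=> phi bphi /lipschitz_continuous cphi.
  rewrite (_ : fine _ = \int[P]_xi phi (limit_value xi)); last by rewrite unlock.
  exact: (average phi cphi bphi).
- by move=> o mo indep; exact: equilibrium_cvg_in_distribution.
Qed.
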